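(* Let $\mathbf{v}_1,\ldots,\mathbf{v}_k\in\mathbb{R}^k$, and let $F:\mathbb{R}^{kn}\to\mathbb{R}$, \[ F(\mathbf{w}_1,\ldots,\mathbf{w}_n)=\mathbb{E}_{\mathbf{x}\sim\mathcal{N}(\mathbf{0},I_k)}\left[\frac{1}{2}\left(\sum_{i=1}^{n}[\mathbf{w}_i^\top\mathbf{x}]_+-\sum_{i=1}^{k}[\mathbf{v}_i^\top\mathbf{x}]_+\right)^2\right]. \] Let $A\subseteq\mathbb{R}^{kn}$ be compact and suppose $F$ is thrice differentiable on $A$. Let $m_A=\min_{(\mathbf{w}_1,\ldots,\mathbf{w}_n)\in A}\min_{i}\|\mathbf{w}_i\|$, $M_A=\max_{(\mathbf{w}_1,\ldots,\mathbf{w}_n)\in A}\max_i\|\mathbf{w}_i\|$, $V=\max_j\|\mathbf{v}_j\|$, and \[ LH=\frac{1}{2}+n(n-1)\left(\frac{M_A}{2\pi m_A}+\frac{1}{2}\right)+\frac{nkV}{2\pi m_A}. \] Then for any $\mathbf{w},\mathbf{w}'\in A$, \[ |F(\mathbf{w}')-F(\mathbf{w})|\le\|\mathbf{w}'-\mathbf{w}\|\left(LH\,\|\mathbf{w}'-\mathbf{w}\|+\|\nabla F(\mathbf{w})\|\right). \]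
   Context: $[z]_+=\max\{0,z\}$; norms are Euclidean. *)

(* Defs.v *)
From HB Require Import structures.
From mathcomp Require Import all_boot all_order all_algebra.
From mathcomp Require Import all_classical all_reals all_analysis.
Set Implicit Arguments. Unset Strict Implicit. Unset Printing Implicit Defensive.
Import Order.TTheory GRing.Theory Num.Theory.
Import numFieldNormedType.Exports.
Local Open Scope classical_set_scope.
Local Open Scope ring_scope.

Section defs.
Context {R : realType}.

Definition relu (z : R) : R := Num.max 0 z.

Definition eucl {k : nat} (u : 'rV[R]_k) : R := Num.sqrt (\sum_(j < k) u 0 j ^+ 2).
Definition frob {n k : nat} (W : 'M[R]_(n, k)) : R :=
  Num.sqrt (\sum_(i < n) \sum_(j < k) W i j ^+ 2).

(* E_{x ~ N(0, I_k)} [g x] for a nonnegative g, as the iterated integral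
   against k independent standard normal coordinates (x given as a list of
   its k coordinates). For nonnegative integrands this equals the integral
   against the product Gaussian measure (Tonelli). *)
Fixpoint gaussE (k : nat) (g : seq R -> \bar R) : \bar R :=
  match k with
  | 0 => g [::]
  | k'.+1 => (\int[normal_prob (0:R) 1]_t gaussE k' (fun s => g (t :: s)))%E
  end.

(* W : 'M_(n,k) has rows w_1..w_n ; Vm : 'M_(k,k) has rows v_1..v_k *)
Definition loss {n k : nat} (Vm : 'M[R]_(k, k)) (W : 'M[R]_(n, k)) (s : seq R) : R :=
  2^-1 * (\sum_(i < n) relu (\sum_(j < k) W i j * nth 0 s j)
          - \sum_(i < k) relu (\sum_(j < k) Vm i j * nth 0 s j)) ^+ 2.

Definition Fobj {n k : nat} (Vm : 'M[R]_(k, k)) (W : 'M[R]_(n, k)) : R :=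
  fine (gaussE k (fun s => (loss Vm W s)%:E)).

Definition grad_norm {n k : nat} (F : 'M[R]_(n, k) -> R) (W : 'M[R]_(n, k)) : R :=
  Num.sqrt (\sum_(i < n) \sum_(j < k) ('D_(delta_mx i j) F W) ^+ 2).

Definition thrice_differentiable_at {n k : nat} (F : 'M[R]_(n, k) -> R)
    (x : 'M[R]_(n, k)) : Prop :=
  (\forall y \near x, differentiable F y /\ forall u, differentiable ('D_u F) y) /\
  (forall u v, differentiable ('D_u ('D_v F)) x).

Definition mA {n k : nat} (A : set 'M[R]_(n, k)) : R :=
  inf [set r | exists W i, A W /\ r = eucl (row i W)].
Definition MA {n k : nat} (A : set 'M[R]_(n, k)) : R :=
  sup [set r | exists W i, A W /\ r = eucl (row i W)].
Definition Vmax {k : nat} (Vm : 'M[R]_(k, k)) : R :=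
  \big[Num.max/0]_(j < k) eucl (row j Vm).

Definition LH {n k : nat} (Vm : 'M[R]_(k, k)) (A : set 'M[R]_(n, k)) : R :=
  2^-1 + (n%:R * (n%:R - 1)) * (MA A / (2 * pi * mA A) + 2^-1)
  + n%:R * k%:R * Vmax Vm / (2 * pi * mA A).

End defs.

(* Main.v *)
Require Import Defs.
From HB Require Import structures.
From mathcomp Require Import all_boot all_order all_algebra.
From mathcomp Require Import all_classical all_reals all_analysis.
From mathcomp Require Import measurable_realfun ring lra.
Set Implicit Arguments. Unset Strict Implicit. Unset Printing Implicit Defensive.
Import Order.TTheory GRing.Theory Num.Theory.
Import numFieldNormedType.Exports.
Local Open Scope classical_set_scope.
Local Open Scope ring_scope.

(** Put f(u, v) = E[relu(u.x) relu(v.x)], so that F is the combination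
    1/2 sum f(w_i, w_j) - sum f(w_i, v_j) + 1/2 sum f(v_i, v_j).  Rotation
    invariance of the Gaussian reduces f to a planar integral, and

      f(u, v) = u.v / 4 + (t u.v + cos t |u| |v|) / (2 pi),

    where t in [-pi/2, pi/2] is the angle with sin t = u.v / (|u| |v|).  From
    this formula the first-order Taylor remainder of f(., v) at w <> 0 lies,
    for every increment d whatsoever, between 0 and |v| |d|^2 / (2 pi |w|).
    The mixed second difference of f is at most (|d|^2 + |e|^2) / 2 because
    relu is 1-Lipschitz.  Summing over all pairs gives
    |F(W + D) - F(W) - G(D)| <= LH |D|^2 with G homogeneous, for every W in A
    and every D; a direct estimate, not one along the segment from W to W',
    which may leave A and even reach w_i = 0.  Letting D tend to 0 identifies
    G with the differential of F at W, and Cauchy-Schwarz bounds G(D) by |grad F(W)| |D|. *)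

(** * Affine changes of variable for Lebesgue measure on the line *)

Section LebesgueInvariance.
Context {R : realType}.
Local Notation mu := (@lebesgue_measure R).
Local Open Scope ereal_scope.

(** The scaled pushforward of [mu] gives every interval ]u, v] its length, and this determines
    Lebesgue measure. *)
Lemma lebesgue_measure_affine (a b : R) (A : set R) : (0 < a)%R -> measurable A ->
  mu A = a%:E * mu ((fun x : measurableTypeR R => (a * x + b)%R : measurableTypeR R) @^-1` A).
Proof.
move=> a0 mA.
have mphi : measurable_fun setT
    (fun x : measurableTypeR R => (a * x + b)%R : measurableTypeR R).
  by apply: measurable_funD => //; exact: measurable_funM.
pose phi := fun x : measurableTypeR R => (a * x + b)%R : measurableTypeR R.
pose nu0 := (mscale (NngNum (ltW a0)) (pushforward mu phi) :
  {measure set (measurableTypeR R) -> \bar R}).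
pose nu := nu0 mphi.
have -> : a%:E * mu ((fun x : measurableTypeR R => (a * x + b)%R : measurableTypeR R) @^-1` A)
   = nu A by [].
apply: lebesgue_measure_unique => //= _ [[u v]] _ <-.
rewrite /mscale/= /pushforward/=.
have -> : (fun x => (a * x + b)%R) @^-1` `]u, v] = `]((u - b) / a)%R, ((v - b) / a)%R]%classic.
  apply/seteqP; split => x /=; rewrite !in_itv/= ltr_pdivrMr// ler_pdivlMr//.
    by rewrite ltrBlDr lerBrDr (mulrC x).
  by rewrite ltrBlDr lerBrDr (mulrC x).
rewrite !lebesgue_measure_itv/= !lte_fin ltr_pM2r ?invr_gt0//.
rewrite ltrBlDr subrK; case: ifP => _; last by rewrite mule0.
by rewrite -!EFinD -EFinM -mulrBl mulrC divfK ?gt_eqF//; congr EFin; ring.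
Qed.

Lemma ge0_integral_affine (a b : R) (f : measurableTypeR R -> \bar R) : (0 < a)%R ->
  measurable_fun setT f -> (forall x, 0 <= f x) ->
  \int[mu]_x f x = a%:E * \int[mu]_x f (a * x + b)%R.
Proof.
move=> a0 mf f0.
have mphi : measurable_fun setT
    (fun x : measurableTypeR R => (a * x + b)%R : measurableTypeR R).
  by apply: measurable_funD => //; exact: measurable_funM.
pose phi := fun x : measurableTypeR R => (a * x + b)%R : measurableTypeR R.
pose nu0 := (mscale (NngNum (ltW a0)) (pushforward mu phi) :
  {measure set (measurableTypeR R) -> \bar R}).
pose nu := nu0 mphi.
transitivity (\int[nu]_x f x).
  by apply: eq_measure_integral => A mA _; exact: lebesgue_measure_affine.
rewrite ge0_integral_mscale//; congr (_ * _).
by rewrite ge0_integral_pushforward.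
Qed.

Lemma ge0_integral_translate (b : R) (f : measurableTypeR R -> \bar R) :
  measurable_fun setT f -> (forall x, 0 <= f x) ->
  \int[mu]_x f (x + b)%R = \int[mu]_x f x.
Proof.
move=> mf f0; rewrite (@ge0_integral_affine 1 b f)// mul1e.
by apply: eq_integral => x _; rewrite mul1r.
Qed.

End LebesgueInvariance.

(** * Gaussian integrals as Lebesgue integrals against the density *)

Section Density.
Context {R : realType}.
Local Notation mu := (@lebesgue_measure R).
Local Open Scope ereal_scope.

Import HBNNSimple.

(** On indicators this is the definition of [normal_prob]; linearity extends it to simple functions
    and monotone convergence to [f]. *)
Lemma ge0_integral_normal_prob (m s : R) (f : measurableTypeR R -> \bar R) :
  measurable_fun setT f -> (forall x, 0 <= f x) ->
  \int[normal_prob m s]_x f x = \int[mu]_x (f x * (normal_pdf m s x)%:E).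
Proof.
move=> mf f0; pose f_ := nnsfun_approx measurableT mf.
have mpdf : measurable_fun setT (fun x : measurableTypeR R => (normal_pdf m s x)%:E).
  by apply/measurable_EFinP; exact: measurable_normal_pdf.
have pdf0 x : 0 <= (normal_pdf m s x)%:E by rewrite lee_fin normal_pdf_ge0.
transitivity (limn (fun n => \int[normal_prob m s]_x (f_ n x)%:E)).
  rewrite -monotone_convergence//.
  - by apply: eq_integral => x _; apply/esym/cvg_lim => //; exact: cvg_nnsfun_approx.
  - by move=> n; exact/measurable_EFinP/measurable_funP.
  - by move=> n x _; rewrite lee_fin.
  - by move=> x _ p q pq; rewrite lee_fin; exact/lefP/nd_nnsfun_approx.
transitivity (limn (fun n => \int[mu]_x ((f_ n x)%:E * (normal_pdf m s x)%:E))); last first.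
  rewrite -monotone_convergence//.
  - apply: eq_integral => x _; apply/cvg_lim => //.
    under eq_fun do rewrite muleC.
    rewrite muleC; apply: cvgeZl => //; exact: cvg_nnsfun_approx.
  - move=> n; apply: emeasurable_funM => //.
    exact/measurable_EFinP/measurable_funP.
  - by move=> n x _; rewrite mule_ge0// lee_fin.
  - move=> x _ p q pq; rewrite lee_wpmul2r//  lee_fin; exact/lefP/nd_nnsfun_approx.
congr (limn _); apply/funext => n.
under eq_integral do rewrite fimfunE -fsumEFin//.
rewrite ge0_integral_fsum//; last 2 first.
- by move=> r; exact/measurable_EFinP/measurableT_comp.
- by move=> r x _; rewrite nnfun_muleindic_ge0.
transitivity (\int[mu]_x (\sum_(r \in range (f_ n))
    ((r * \1_(f_ n @^-1` [set r]) x)%:E * (normal_pdf m s x)%:E))); last first.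
  apply: eq_integral => x _; rewrite -ge0_mule_fsuml.
    by rewrite fsumEFin// -fimfunE.
  by move=> r; rewrite nnfun_muleindic_ge0.
rewrite ge0_integral_fsum//; last 2 first.
- move=> r; apply: emeasurable_funM => //.
  exact/measurable_EFinP/measurableT_comp.
- by move=> r x _; rewrite mule_ge0// nnfun_muleindic_ge0.
apply: eq_fsbigr => r; rewrite inE => -[x0 _ <-].
have rge0 : (0 <= f_ n x0)%R by [].
under eq_integral do rewrite EFinM.
rewrite ge0_integralZl//; last exact/measurable_EFinP.
rewrite integral_indic//= setIT /normal_prob.
under [RHS]eq_integral do rewrite EFinM -muleA.
rewrite ge0_integralZl//; last 2 first.
- by apply: emeasurable_funM => //; exact/measurable_EFinP.
- by move=> x _; rewrite mule_ge0// lee_fin.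
congr (_ * _); rewrite [LHS]integral_mkcond; apply: eq_integral => x _.
by rewrite patchE indicE; case: ifPn => _; rewrite ?mul1e ?mul0e.
Qed.

End Density.

(** * Rotation invariance of the planar Gaussian *)

Section GaussianRotation.
Context {R : realType}.
Local Notation rT := (measurableTypeR R).
Local Notation mu := (@lebesgue_measure R).
Local Notation gam := (@normal_prob R 0 1).
Local Notation phi := (@normal_pdf R 0 1).
Local Open Scope ereal_scope.

Implicit Type H : rT * rT -> \bar R.

Lemma measurable_shear_snd (t : R) :
  measurable_fun setT (fun z : rT * rT => (z.1, (z.2 + t * z.1)%R) : rT * rT).
Proof.
apply/measurable_fun_pairP; split => /=; first exact: measurable_fst.
apply: measurable_funD; first exact: measurable_snd.
by apply: measurable_funM => //; exact: measurable_fst.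
Qed.

Lemma measurable_shear_fst (t : R) :
  measurable_fun setT (fun z : rT * rT => ((z.1 + t * z.2)%R, z.2) : rT * rT).
Proof.
apply/measurable_fun_pairP; split => /=; last exact: measurable_snd.
apply: measurable_funD; first exact: measurable_fst.
by apply: measurable_funM => //; exact: measurable_snd.
Qed.

Lemma ge0_integral_shear_snd H (t : R) :
  measurable_fun setT H -> (forall z, 0 <= H z) ->
  \int[mu]_x \int[mu]_y H (x, (y + t * x)%R) = \int[mu]_x \int[mu]_y H (x, y).
Proof.
move=> mH H0; apply: eq_integral => x _.
apply: (@ge0_integral_translate R (t * x)%R (fun y => H (x, y))) => //.
exact: measurableT_comp mH (measurable_pair1 x).
Qed.

(** The sheared variable is the outer one: Tonelli moves it inside, where the shear is a
    translation, and back. *)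
Lemma ge0_integral_shear_fst H (t : R) :
  measurable_fun setT H -> (forall z, 0 <= H z) ->
  \int[mu]_x \int[mu]_y H ((x + t * y)%R, y) = \int[mu]_x \int[mu]_y H (x, y).
Proof.
move=> mH H0.
pose H' := H \o (fun z : rT * rT => ((z.1 + t * z.2)%R, z.2) : rT * rT).
have mH' : measurable_fun setT H' by exact: measurableT_comp mH (measurable_shear_fst t).
transitivity (\int[mu]_y \int[mu]_x H' (x, y)).
  apply: (@fubini_tonelli _ _ _ _ _ mu mu H') => // z; exact: H0.
transitivity (\int[mu]_y \int[mu]_x H (x, y)); last first.
  by apply/esym; exact: (@fubini_tonelli _ _ _ _ _ mu mu H).
apply: eq_integral => y _.
apply: (@ge0_integral_translate R (t * y)%R (fun x => H (x, y))) => //.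
exact: measurableT_comp mH (measurable_pair2 y).
Qed.

(* A rotation by an angle other than pi is a product of three shears. *)
Lemma ge0_integral_rotation H (c s : R) :
  (c ^+ 2 + s ^+ 2 = 1)%R -> (0 <= c)%R ->
  measurable_fun setT H -> (forall z, 0 <= H z) ->
  \int[mu]_x \int[mu]_y H ((c * x + s * y)%R, (- s * x + c * y)%R) =
  \int[mu]_x \int[mu]_y H (x, y).
Proof.
(* [t] is the tangent of half the angle. The shears have slopes [t], [- s], [t]; the half-angle
   identities [tE] and [stE] multiply them out to the rotation. *)
move=> cs c0 mH H0; pose t := (s / (1 + c))%R.
have c1 : (1 + c != 0)%R by rewrite gt_eqF// ltr_pwDl.
have tE : (t * (1 + c) = s)%R by rewrite /t divfK.
have stE : (1 - s * t = c)%R.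
  apply: (mulIf c1); rewrite mulrBl -mulrA tE mul1r; lra.
rewrite -(ge0_integral_shear_fst t mH H0).
pose S1 := (fun z : rT * rT => ((z.1 + t * z.2)%R, z.2) : rT * rT).
pose S2 := (fun z : rT * rT => (z.1, (z.2 + - s * z.1)%R) : rT * rT).
have mH1 : measurable_fun setT (H \o S1).
  exact: measurableT_comp mH (measurable_shear_fst t).
have mH2 : measurable_fun setT (H \o S1 \o S2).
  exact: measurableT_comp mH1 (measurable_shear_snd (- s)).
have H1 z : 0 <= (H \o S1) z by exact: H0.
have H2 z : 0 <= (H \o S1 \o S2) z by exact: H0.
rewrite -[RHS](ge0_integral_shear_snd (- s) mH1 H1).
rewrite -[RHS](ge0_integral_shear_fst t mH2 H2).
apply: eq_integral => x _; apply: eq_integral => y _.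
rewrite /S1 /S2 /=; congr (H (_, _)).
  rewrite -[in LHS]tE -[in LHS]stE; ring.
rewrite -[in LHS]stE; ring.
Qed.

Lemma normal_pdf01M (x y : R) :
  (phi x * phi y = normal_peak 1 ^+ 2 * expR (- (x ^+ 2 + y ^+ 2) / 2))%R.
Proof.
rewrite !normal_pdfE ?oner_neq0// /normal_fun !subr0 expr1n.
rewrite mulrACA -expRD -expr2; congr (_ * expR _)%R; lra.
Qed.

Lemma measurable_normal_pdfM :
  measurable_fun setT (fun z : rT * rT => (phi z.1 * phi z.2)%:E).
Proof.
apply/measurable_EFinP/measurable_funM.
  exact: measurableT_comp (measurable_normal_pdf _ _) measurable_fst.
exact: measurableT_comp (measurable_normal_pdf _ _) measurable_snd.
Qed.

Lemma ge0_integral_normal_prob2 H :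
  measurable_fun setT H -> (forall z, 0 <= H z) ->
  \int[gam]_x \int[gam]_y H (x, y) =
  \int[mu]_x \int[mu]_y (H (x, y) * (phi x * phi y)%:E).
Proof.
move=> mH H0.
rewrite ge0_integral_normal_prob; last 2 first.
- exact: (@measurable_fun_fubini_tonelli_F _ _ _ _ _ gam H).
- by move=> x; apply: integral_ge0.
apply: eq_integral => x _.
have mHx : measurable_fun setT (fun y => H (x, y)).
  exact: measurableT_comp mH (measurable_pair1 x).
have mp : measurable_fun setT (fun y : rT => (phi y)%:E).
  by apply/measurable_EFinP; exact: measurable_normal_pdf.
rewrite ge0_integral_normal_prob// -ge0_integralZr//; last 3 first.
- exact: emeasurable_funM.
- by move=> y _; rewrite mule_ge0// lee_fin normal_pdf_ge0.
- by rewrite lee_fin normal_pdf_ge0.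
by apply: eq_integral => y _; rewrite -muleA -EFinM (mulrC (phi y)).
Qed.

(** The joint density depends only on x^2 + y^2, so it can be absorbed into the integrand before
    Lebesgue measure is rotated. *)
Lemma ge0_integral_normal_rotation H (c s : R) :
  (c ^+ 2 + s ^+ 2 = 1)%R -> (0 <= c)%R ->
  measurable_fun setT H -> (forall z, 0 <= H z) ->
  \int[gam]_x \int[gam]_y H ((c * x + s * y)%R, (- s * x + c * y)%R) =
  \int[gam]_x \int[gam]_y H (x, y).
Proof.
move=> cs c0 mH H0.
pose rot := (fun z : rT * rT => ((c * z.1 + s * z.2)%R, (- s * z.1 + c * z.2)%R) : rT * rT).
have mrot : measurable_fun setT rot.
  apply/measurable_fun_pairP; split; apply: measurable_funD;
    apply: measurable_funM => //; by [exact: measurable_fst|exact: measurable_snd].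
have mHr : measurable_fun setT (H \o rot) by exact: measurableT_comp mH mrot.
have Hr0 z : 0 <= (H \o rot) z by exact: H0.
rewrite (ge0_integral_normal_prob2 mH H0).
transitivity (\int[mu]_x \int[mu]_y ((H \o rot) (x, y) * (phi x * phi y)%:E)).
  exact: ge0_integral_normal_prob2 mHr Hr0.
pose K := fun z : rT * rT => H z * (phi z.1 * phi z.2)%:E.
transitivity (\int[mu]_x \int[mu]_y K ((c * x + s * y)%R, (- s * x + c * y)%R)); last first.
  apply: (ge0_integral_rotation cs c0).
  - by apply: emeasurable_funM => //; exact: measurable_normal_pdfM.
  - by move=> z; rewrite mule_ge0// lee_fin mulr_ge0// normal_pdf_ge0.
apply: eq_integral => x _; apply: eq_integral => y _.
rewrite /K /rot /=; congr (_ * _%:E); rewrite !normal_pdf01M.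
congr (_ * expR (- _ / 2))%R.
rewrite -[LHS]mul1r -cs; ring.
Qed.

End GaussianRotation.

(** * Iterated Gaussian expectations and the joint law of two linear forms *)

Section IteratedGaussian.
Context {R : realType}.
Local Notation rT := (measurableTypeR R).
Local Notation gam := (@normal_prob R 0 1).
Local Open Scope ereal_scope.

(* Joint measurability of [f t [:: x_1; ...; x_k]] in the parameter [t] and the
   coordinates; the parameter type absorbs one coordinate per integration. *)
Fixpoint gmeas (k : nat) d (T : measurableType d) (f : T -> seq R -> \bar R) : Prop :=
  match k with
  | 0 => measurable_fun setT (fun t => f t [::])
  | k'.+1 => gmeas k' (fun (p : T * rT) s => f p.1 (p.2 :: s))
  end.

Lemma gaussE_ge0 k (g : seq R -> \bar R) : (forall s, 0 <= g s) -> 0 <= gaussE k g.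
Proof.
elim: k g => [|k IH] g g0 //=; apply: integral_ge0 => x _; exact: IH.
Qed.

Lemma eq_gaussE k (f g : seq R -> \bar R) : f =1 g -> gaussE k f = gaussE k g.
Proof. by move=> /funext ->. Qed.

Lemma measurable_gaussE k d (T : measurableType d) (f : T -> seq R -> \bar R) :
  gmeas k f -> (forall t s, 0 <= f t s) -> measurable_fun setT (fun t => gaussE k (f t)).
Proof.
elim: k d T f => [|k IH] d T f //= mf f0.
apply: (@measurable_fun_fubini_tonelli_F _ _ T rT R gam
  (fun p => gaussE k (fun s => f p.1 (p.2 :: s)))).
- exact: IH.
- by move=> p; apply: gaussE_ge0.
Qed.

Lemma gmeas_cst k d (T : measurableType d) (c : \bar R) :
  gmeas k (fun (_ : T) _ => c).
Proof. by elim: k d T => [|k IH] d T //=; exact: IH. Qed.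

Definition lform k (w : 'I_k -> R) (s : seq R) : R := (\sum_(j < k) w j * nth 0%R s j)%R.

Lemma lform_cons k (w : 'I_k.+1 -> R) x s :
  lform w (x :: s) = (w ord0 * x + lform (fun j => w (lift ord0 j)) s)%R.
Proof. by rewrite /lform big_ord_recl. Qed.

(** The offsets [a] and [b] collect the coordinates already moved into the parameter; this is what
    makes the induction on [k] close. *)
Lemma gmeas_lform2 k d (T : measurableType d) (g : rT * rT -> \bar R)
    (a b : T -> rT) (w v : 'I_k -> R) :
  measurable_fun setT g -> measurable_fun setT a -> measurable_fun setT b ->
  gmeas k (fun t s => g ((a t + lform w s)%R, (b t + lform v s)%R)).
Proof.
move=> mg; elim: k d T a b w v => [|k IH] d T a b w v ma mb /=.
  rewrite /lform; under eq_fun do rewrite !big_ord0 !addr0.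
  by apply: measurableT_comp mg _; apply/measurable_fun_pairP.
rewrite [X in gmeas k X](_ : _ = (fun (p : T * rT) s => g
    ((a p.1 + w ord0 * p.2 + lform (fun j => w (lift ord0 j)) s)%R,
     (b p.1 + v ord0 * p.2 + lform (fun j => v (lift ord0 j)) s)%R))); last first.
  by apply/funext => p; apply/funext => s; rewrite !lform_cons !addrA.
pose a' (p : T * rT) : rT := (a p.1 + w ord0 * p.2)%R.
pose b' (p : T * rT) : rT := (b p.1 + v ord0 * p.2)%R.
apply: (IH _ _ a' b').
- apply: measurable_funD; first exact: measurableT_comp ma measurable_fst.
  by apply: measurable_funM => //; exact: measurable_snd.
- apply: measurable_funD; first exact: measurableT_comp mb measurable_fst.
  by apply: measurable_funM => //; exact: measurable_snd.
Qed.

Lemma gaussED k d (T : measurableType d) (f g : T -> seq R -> \bar R) t :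
  gmeas k f -> gmeas k g -> (forall t s, 0 <= f t s) -> (forall t s, 0 <= g t s) ->
  gaussE k (fun s => f t s + g t s) = gaussE k (f t) + gaussE k (g t).
Proof.
elim: k d T f g t => [|k IH] d T f g t //= mf mg f0 g0.
rewrite -ge0_integralD//; first last.
- have m := measurable_gaussE mg (fun p s => g0 p.1 (p.2 :: s)).
  exact: measurableT_comp m (pair1_measurable t).
- by move=> x _; apply: gaussE_ge0.
- have m := measurable_gaussE mf (fun p s => f0 p.1 (p.2 :: s)).
  exact: measurableT_comp m (pair1_measurable t).
- by move=> x _; apply: gaussE_ge0.
apply: eq_integral => x _.
by apply: (IH _ _ (fun (p : T * rT) s => f p.1 (p.2 :: s))
  (fun (p : T * rT) s => g p.1 (p.2 :: s)) (t, x)).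
Qed.

Lemma polar_decomposition (a w : R) : (0 <= a)%R ->
  exists r c s : R, [/\ (0 <= r)%R, (0 <= c)%R, (c ^+ 2 + s ^+ 2 = 1)%R, a = (r * c)%R & w = (r * s)%R].
Proof.
move=> a0; pose r := Num.sqrt (a ^+ 2 + w ^+ 2)%R.
have r2 : (r ^+ 2 = a ^+ 2 + w ^+ 2)%R by rewrite sqr_sqrtr// addr_ge0// sqr_ge0.
have [r0|r0] := eqVneq r 0%R.
  exists 0%R, 1%R, 0%R; move: r2; rewrite r0 expr0n/= => /esym/eqP.
  rewrite paddr_eq0 ?sqr_ge0// !sqrf_eq0 => /andP[/eqP -> /eqP ->].
  by split; rewrite ?mul0r//; ring.
exists r, (a / r)%R, (w / r)%R; split.
- exact: sqrtr_ge0.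
- by rewrite divr_ge0// sqrtr_ge0.
- by rewrite !exprMn -mulrDl -r2 exprVn divff// sqrf_eq0.
- by rewrite mulrC divfK.
- by rewrite mulrC divfK.
Qed.

(** The two forms are jointly Gaussian, so two independent normals suffice; [a], [b], [c] are the
    Cholesky coefficients of the Gram matrix of [w] and [v]. Inductively, a new coordinate t gives
    the pair (w0 t + a x, v0 t + b x + c y) in three normals, and two rotations bring it back to
    two. *)
Lemma gaussian_pair (k : nat) (w v : 'I_k -> R) :
  exists a b c : R,
    [/\ (0 <= a)%R, (0 <= c)%R,
      [/\ (a ^+ 2 = \sum_j w j ^+ 2)%R, (a * b = \sum_j w j * v j)%R &
       (b ^+ 2 + c ^+ 2 = \sum_j v j ^+ 2)%R] &
      forall g : rT * rT -> \bar R, measurable_fun setT g -> (forall z, 0 <= g z) ->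
        gaussE k (fun s => g (lform w s, lform v s)) =
        \int[gam]_x \int[gam]_y g ((a * x)%R, (b * x + c * y)%R)].
Proof.
elim: k w v => [|k IH] w v.
  exists 0%R, 0%R, 0%R; split => //.
    by rewrite !big_ord0; split; ring.
  move=> g mg g0 /=; rewrite /lform !big_ord0.
  under eq_integral do under eq_integral do rewrite !mul0r addr0.
  under eq_integral do rewrite integral_cst// [X in _ * X]probability_setT mule1.
  by rewrite integral_cst// [X in _ * X]probability_setT mule1.
have [a [b [c [a0 c0 [aE abE bcE] gE]]]] := IH (fun j => w (lift ord0 j)) (fun j => v (lift ord0 j)).
have [r [c1 [s1 [r0 c10 cs1 raE rwE]]]] := polar_decomposition (w ord0) a0.
pose b' := (b * c1 + v ord0 * s1)%R.
pose e := (v ord0 * c1 - b * s1)%R.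
have [r2 [c2 [s2 [r20 c20 cs2 rcE reE]]]] := polar_decomposition e c0.
exists r, b', r2; split => //.
  rewrite !big_ord_recl -aE -abE -bcE; split.
  - by rewrite raE rwE -[LHS]mulr1 -cs1; ring.
  - by rewrite rwE raE /b'; ring.
  - have -> : (r2 ^+ 2 = c ^+ 2 + e ^+ 2)%R.
      by rewrite rcE reE -[LHS]mulr1 -cs2; ring.
    transitivity ((v ord0 ^+ 2 + b ^+ 2) * (c1 ^+ 2 + s1 ^+ 2) + c ^+ 2)%R.
      by rewrite /b' /e; ring.
    by rewrite cs1; ring.
move=> g mg g0 /=.
have maff (l m n : R) d (T : measurableType d) (x y z : T -> rT) :
    measurable_fun setT x -> measurable_fun setT y -> measurable_fun setT z ->
    measurable_fun setT (fun t => (l * x t + m * y t + n * z t)%R : rT).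
  move=> mx my mz; apply: measurable_funD; last exact: measurable_funM.
  by apply: measurable_funD; exact: measurable_funM.
have m1 : measurable_fun setT (fun z : rT * rT * rT => z.1.1).
  exact: measurableT_comp measurable_fst measurable_fst.
have m2 : measurable_fun setT (fun z : rT * rT * rT => z.1.2).
  exact: measurableT_comp measurable_snd measurable_fst.
have m3 : measurable_fun setT (fun z : rT * rT * rT => z.2) by exact: measurable_snd.
have mcomp d (T : measurableType d) (h1 h2 : T -> rT) : measurable_fun setT h1 ->
    measurable_fun setT h2 -> measurable_fun setT (fun t => g (h1 t, h2 t)).
  by move=> mh1 mh2; apply: measurableT_comp mg _; apply/measurable_fun_pairP.
pose H3 (z : rT * rT * rT) := g ((r * z.1.2)%R, (e * z.1.1 + b' * z.1.2 + c * z.2)%R).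
have mH3 : measurable_fun setT H3.
  rewrite /H3; apply: (mcomp _ _ (fun z : rT * rT * rT => r * z.1.2)%R
    (fun z : rT * rT * rT => e * z.1.1 + b' * z.1.2 + c * z.2)%R).
    exact: measurable_funM.
  exact: maff.
pose H (z : rT * rT) := \int[gam]_y H3 (z, y).
have mH : measurable_fun setT H.
  by apply: (@measurable_fun_fubini_tonelli_F _ _ _ _ _ gam H3) => // z; exact: g0.
have H0 z : 0 <= H z by apply: integral_ge0 => y _; exact: g0.
(* The first rotation, in the (t, x) plane, turns w0 t + a x into a multiple [r] of one variable.
   The second form then has coefficients [e], [b'] and [c]. *)
transitivity (\int[gam]_t \int[gam]_x H ((c1 * t + - s1 * x)%R, (- - s1 * t + c1 * x)%R)).
  apply: eq_integral => t _.
  pose gt (p : rT * rT) := g ((w ord0 * t + p.1)%R, (v ord0 * t + p.2)%R).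
  rewrite (@eq_gaussE k _ (fun s => gt (lform (fun j => w (lift ord0 j)) s,
    lform (fun j => v (lift ord0 j)) s))); last by move=> s; rewrite !lform_cons.
  rewrite gE; last 2 first.
  - by apply: mcomp; apply: measurable_funD.
  - by move=> z; exact: g0.
  apply: eq_integral => x _; apply: eq_integral => y _.
  rewrite /gt /H3 /=; congr (g (_, _)).
    by rewrite raE rwE; ring.
  transitivity (v ord0 * t * (c1 ^+ 2 + s1 ^+ 2) + b * x * (c1 ^+ 2 + s1 ^+ 2) + c * y)%R.
    by rewrite cs1 !mulr1 addrA.
  by rewrite /b' /e; ring.
rewrite (ge0_integral_normal_rotation _ c10 mH H0) ?sqrrN//.
(* After swapping x and t, the second rotation, in the (t, y) plane, merges e t + c y into [r2]
   times one variable; the other one integrates to 1. *)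
transitivity (\int[gam]_x \int[gam]_t H (t, x)).
  exact: (@fubini_tonelli _ _ _ _ _ gam gam H).
apply: eq_integral => x _.
pose H2 (z : rT * rT) := g ((r * x)%R, (b' * x + r2 * z.2)%R).
transitivity (\int[gam]_t \int[gam]_y H2 ((c2 * t + - s2 * y)%R, (- - s2 * t + c2 * y)%R)).
  apply: eq_integral => t _; apply: eq_integral => y _.
  rewrite /H3 /H2 /=; congr (g (_, _)).
  by rewrite reE rcE; ring.
have mH2 : measurable_fun setT H2.
  by apply: mcomp => //; apply: measurable_funD => //; exact: measurable_funM.
rewrite (ge0_integral_normal_rotation _ c20 mH2) ?sqrrN//; last by move=> z; exact: g0.
by rewrite /H2/= integral_cst// [X in _ * X]probability_setT mule1.
Qed.

End IteratedGaussian.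

(** * Two explicit integrals: a radial one and a rational one *)

Section RadialIntegral.
Context {R : realType}.
Local Notation rT := (measurableTypeR R).
Local Notation mu := (@lebesgue_measure R).

(** Half of the exponent absorbs the linear factor, since 1 + u <= 2 exp (u / 2). *)
Lemma cvg_oneDx_expRN : (1 + u) * expR (- u) @[u --> +oo] --> (0 : R).
Proof.
have h : 2 * expR (- (2^-1 * u)) @[u --> +oo] --> (0 : R).
  rewrite -(mulr0 2); apply: cvgMr => //.
  apply: (cvg_comp (fun u => 2^-1 * u) (fun x => expR (- x))); last exact: cvgr_expR.
  by apply: gt0_cvgMry => //; rewrite invr_gt0.
apply: squeeze_cvgr h; last exact: cvg_cst.
near=> u.
have u0 : 0 <= u by near: u; exact: nbhs_pinfty_ge.
apply/andP; split; first by rewrite mulr_ge0 ?expR_ge0// addr_ge0.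
have -> : expR (- u) = expR (- (2^-1 * u)) * expR (- (2^-1 * u)).
  by rewrite -expRD; congr expR; lra.
rewrite mulrA ler_wpM2r ?expR_ge0// -ler_pdivlMr ?expR_gt0// -expRN opprK.
rewrite (@le_trans _ _ (2 * (1 + 2^-1 * u)))//; first lra.
by rewrite ler_wpM2l// expR_ge1Dx.
Unshelve. all: by end_near. Qed.

Lemma integral_cube_gauss (q : R) : 0 < q ->
  (\int[mu]_(x in `[0%R, +oo[) (x ^+ 3 * expR (- (q / 2 * x ^+ 2)))%:E = (2 / q ^+ 2)%:E)%E.
Proof.
move=> q0.
(* An antiderivative: put z = q x^2 / 2 and integrate z exp (- z) by parts. It tends to 0 at
   infinity. *)
pose F (x : R) : R := - (2 / q ^+ 2) * ((1 + q / 2 * x ^+ 2) * expR (- (q / 2 * x ^+ 2))).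
have dF (x : R) : is_derive x 1 F (x ^+ 3 * expR (- (q / 2 * x ^+ 2))).
  rewrite /F; apply: is_derive_eq.
  rewrite /GRing.scale/= ; field.
  by rewrite gt_eqF.
rewrite (@ge0_continuous_FTC2y _ _ F 0 0).
- by rewrite -EFinB /F expr0n/= mulr0 addr0 oppr0 expR0 !mulr1 sub0r opprK.
- by move=> x x0; rewrite mulr_ge0 ?expR_ge0// exprn_ge0.
- apply: continuous_subspaceT => x.
  apply: differentiable_continuous; exact/derivable1_diffP.
- rewrite -(mulr0 (- (2 / q ^+ 2))); apply: cvgMr => //.
  apply: (cvg_comp (fun x => q / 2 * x ^+ 2) (fun u => (1 + u) * expR (- u))); last exact: cvg_oneDx_expRN.
  by apply: gt0_cvgMry; [rewrite divr_gt0|exact: cvgr_expr2].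
- by move=> x _; have [] := dF x.
- apply: cvg_at_right_filter; apply: differentiable_continuous.
  by apply/derivable1_diffP; have [] := dF 0.
- by move=> x _; rewrite derive1E; exact: derive_val.
Qed.

Lemma continuous_sqr_oneDsqrV :
  continuous (fun y : R => ((1 + y ^+ 2) ^+ 2)^-1).
Proof.
move=> x; apply: cvgV; first by rewrite expf_neq0// gt_eqF// ltr_pwDl// sqr_ge0.
apply: (cvg_comp (fun y : R => 1 + y ^+ 2) (fun z : R => z ^+ 2)).
  by apply: cvgD; [exact: cvg_cst|exact: exprn_continuous].
exact: exprn_continuous.
Qed.

Lemma integral_rational (b c y0 : R) : (forall y, y0 <= y -> 0 <= b + c * y) ->
  (\int[mu]_(y in `[y0, +oo[) ((b + c * y) / (1 + y ^+ 2) ^+ 2)%:E =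
   (b * pi / 4 - (b / 2 * (y0 / (1 + y0 ^+ 2) + atan y0) - c / 2 / (1 + y0 ^+ 2)))%:E)%E.
Proof.
move=> bc0.
(* The [b] part is a primitive of b / (1 + y^2)^2, the [c] part one of c y / (1 + y^2)^2; the limit
   at infinity is b pi / 4. *)
pose P (y : R) : R := b / 2 * (y / (1 + y ^+ 2) + atan y) - c / 2 / (1 + y ^+ 2).
have n0 (y : R) : 1 + y ^+ 2 != 0 by rewrite gt_eqF// ltr_pwDl// sqr_ge0.
have dP (y : R) : is_derive y 1 P ((b + c * y) / (1 + y ^+ 2) ^+ 2).
  rewrite /P; apply: is_derive_eq.
  rewrite /GRing.scale/= ; field.
  by rewrite n0.
rewrite (@ge0_continuous_FTC2y _ _ P y0 (b * pi / 4)).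
- by rewrite -EFinB.
- by move=> x x0; rewrite divr_ge0 ?bc0// exprn_ge0// addr_ge0// sqr_ge0.
- apply: continuous_subspaceT => x; apply: cvgM.
    by apply: cvgD; [exact: cvg_cst|apply: cvgMr; exact: cvg_id].
  exact: continuous_sqr_oneDsqrV.
- have cV : (1 + y ^+ 2)^-1 @[y --> +oo] --> (0 : R).
    apply/gtr0_cvgV0; first by near=> y; rewrite ltr_pwDl// sqr_ge0.
    apply: (@ger_cvgy _ _ _ _ (fun y : R => y ^+ 2)); last exact: cvgr_expr2.
    by near=> y; rewrite lerDr.
  have cyV : y / (1 + y ^+ 2) @[y --> +oo] --> (0 : R).
    have cI : y^-1 @[y --> +oo] --> (0 : R).
      by apply/gtr0_cvgV0; [exact: nbhs_pinfty_gt|exact: cvg_id].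
    apply: squeeze_cvgr cI; last exact: cvg_cst.
    near=> y.
    have y0' : 0 < y by near: y; exact: nbhs_pinfty_gt.
    rewrite divr_ge0 ?addr_ge0 ?sqr_ge0 ?(ltW y0')//= ler_pdivrMr ?ltr_pwDl ?sqr_ge0//.
    by rewrite mulrDr mulr1 expr2 mulKf ?gt_eqF// lerDr invr_ge0 ltW.
  rewrite [X in _ --> X](_ : _ = b / 2 * (0 + pi / 2) - c / 2 * 0); last lra.
  apply: cvgB; last exact: cvgMr.
  by apply: cvgMr; apply: cvgD => //; exact: cvgy_atan.
- by move=> x _; have [] := dP x.
- apply: cvg_at_right_filter; apply: differentiable_continuous.
  by apply/derivable1_diffP; have [] := dP y0.
- by move=> x _; rewrite derive1E; exact: derive_val.
Unshelve. all: by end_near. Qed.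

End RadialIntegral.

(** * The planar mean of a product of two relus *)

Section ReluPair.
Context {R : realType}.
Local Notation rT := (measurableTypeR R).
Local Notation mu := (@lebesgue_measure R).
Local Notation gam := (@normal_prob R 0 1).
Local Notation phi := (@normal_pdf R 0 1).

Lemma relu_ge0 (z : R) : 0 <= relu z.
Proof. by rewrite /relu le_max lexx. Qed.

Lemma relu_pos (z : R) : 0 <= z -> relu z = z.
Proof. by move=> z0; rewrite /relu; apply/max_idPr. Qed.

Lemma relu_neg (z : R) : z <= 0 -> relu z = 0.
Proof. by move=> z0; rewrite /relu; apply/max_idPl. Qed.

Lemma relu_pMl (a z : R) : 0 <= a -> relu (a * z) = a * relu z.
Proof.
move=> a0; have [z0|/ltW z0] := leP 0 z; first by rewrite !relu_pos// mulr_ge0.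
by rewrite !relu_neg ?mulr0// mulr_ge0_le0.
Qed.

Lemma measurable_relu : measurable_fun setT (@relu R : rT -> rT).
Proof. exact: measurable_maxr. Qed.

(** The range of the arcsine: [t] is the complement of the usual angle between two vectors, so on it
    sine is increasing and cosine nonnegative. *)
Definition is_angle (t : R) := - (pi / 2) <= t <= pi / 2.

Lemma polar_angle (b c : R) : 0 < c ->
  b = Num.sqrt (b ^+ 2 + c ^+ 2) * sin (atan (b / c)) /\
  c = Num.sqrt (b ^+ 2 + c ^+ 2) * cos (atan (b / c)).
Proof.
move=> c0.
have cosE : Num.sqrt (b ^+ 2 + c ^+ 2) * cos (atan (b / c)) = c.
  rewrite cos_atan.
  have -> : b ^+ 2 + c ^+ 2 = c ^+ 2 * (1 + (b / c) ^+ 2).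
    by field; rewrite gt_eqF.
  rewrite sqrtrM ?sqr_ge0// sqrtr_sqr (gtr0_norm c0) mulfK//.
  by rewrite gt_eqF// sqrtr_gt0 ltr_pwDl// sqr_ge0.
split => //.
have cos0 : cos (atan (b / c)) != 0.
  by rewrite gt_eqF// cos_gt0_pihalf// atan_gtNpi2 atan_ltpi2.
have := atanK (b / c); rewrite /tan => /(canRL (divfK cos0)) ->.
by rewrite mulrC -mulrA (mulrC (cos _)) cosE divfK// gt_eqF.
Qed.

(** For c > 0 the relu cuts the line at y = - b / c, where the arctangent in the primitive equals -
    t, with t the angle of slope b / c. *)
Lemma integral_relu_rational (b c : R) : 0 <= c ->
  exists t : R, [/\ is_angle t, b = Num.sqrt (b ^+ 2 + c ^+ 2) * sin t,
    c = Num.sqrt (b ^+ 2 + c ^+ 2) * cos t &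
    (\int[mu]_y (relu (b + c * y) / (1 + y ^+ 2) ^+ 2)%:E =
     (b * pi / 4 + (c + b * t) / 2)%:E)%E].
Proof.
have pi20 : 0 < pi / 2 :> R by rewrite divr_gt0// pi_gt0.
have n0 (y : R) : 0 < 1 + y ^+ 2 by rewrite ltr_pwDl// sqr_ge0.
(* For c = 0 there is no cut: the argument of relu is the constant [b], and its sign selects the end
   pi / 2 or - pi / 2. *)
rewrite le_eqVlt => /predU1P[<-|c0].
  rewrite expr0n/= addr0 sqrtr_sqr.
  have [b0|/ltW b0] := leP 0 b.
    exists (pi / 2); rewrite /is_angle lexx sin_pihalf cos_pihalf mulr1 mulr0 ger0_norm//.
    split => //; first by rewrite andbT; lra.
    under eq_integral do rewrite mul0r addr0 relu_pos//.
    rewrite ge0_symfun_integralT.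
    - have := @integral_rational R b 0 0; rewrite -set_itvcy.
      under eq_integral do rewrite mul0r addr0.
      move=> ->; last by move=> y _; rewrite mul0r addr0.
      rewrite -EFinM atan0; congr EFin; lra.
    - by move=> y; rewrite divr_ge0// exprn_ge0// ltW.
    - move=> y; apply: cvgM; first exact: cvg_cst.
      exact: continuous_sqr_oneDsqrV.
    - by move=> y /=; rewrite sqrrN.
  exists (- (pi / 2)); rewrite /is_angle lexx sinN cosN sin_pihalf cos_pihalf mulr0 ler0_norm//.
  split => //=; first lra.
    by rewrite mulrN mulr1 opprK.
  under eq_integral do rewrite mul0r addr0 relu_neg// mul0r.
  rewrite integral0; congr EFin; lra.
exists (atan (b / c)); have [bE cE] := polar_angle b c0; split => //.
  by rewrite /is_angle !ltW ?atan_gtNpi2 ?atan_ltpi2.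
have hy (y : R) : (- b / c <= y) = (0 <= b + c * y).
  by rewrite ler_pdivrMr//; apply/idP/idP; lra.
transitivity (\int[mu]_(y in `[(- b / c)%R, +oo[) ((b + c * y) / (1 + y ^+ 2) ^+ 2)%:E)%E.
  rewrite [RHS]integral_mkcond; apply: eq_integral => y _; rewrite patchE.
  case: ifPn; rewrite ?inE ?notin_setE/= in_itv/= andbT hy => h.
    by rewrite relu_pos.
  by rewrite relu_neg ?mul0r//; move/negP: h; rewrite -ltNge => /ltW.
rewrite integral_rational; last first.
  by move=> y; rewrite hy.
congr EFin; rewrite mulNr atanN; field.
by rewrite !gt_eqF// ltr_pwDl ?sqr_ge0// exprn_gt0.
Qed.

Lemma normal_peak1_sqr : normal_peak (1 : R) ^+ 2 = (2 * pi)^-1.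
Proof.
rewrite /normal_peak expr1n mul1r exprVn sqr_sqrtr; first by rewrite -mulr_natl.
by rewrite mulrn_wge0// pi_ge0.
Qed.

(* The substitution [y = x * u] turns the planar integral of a homogeneous
   function into a product of a radial integral in [x] and a rational
   integral in the slope [u]. *)
Lemma integral_relu_pair (a b c : R) : 0 <= a -> 0 <= c ->
  exists t : R, [/\ is_angle t, b = Num.sqrt (b ^+ 2 + c ^+ 2) * sin t,
    c = Num.sqrt (b ^+ 2 + c ^+ 2) * cos t &
    (\int[gam]_x \int[gam]_y (relu (a * x) * relu (b * x + c * y))%:E =
     (a * (b / 4 + (c + b * t) / (2 * pi)))%:E)%E].
Proof.
move=> a0 c0; have [t [t1 bE cE tE]] := integral_relu_rational b c0.
exists t; split => //.
pose H (z : rT * rT) := (relu (a * z.1) * relu (b * z.1 + c * z.2))%:E.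
have mH : measurable_fun setT H.
  apply/measurable_EFinP; apply: measurable_funM; apply: measurableT_comp measurable_relu _.
    by apply: measurable_funM.
  by apply: measurable_funD; apply: measurable_funM.
have H0 z : (0 <= H z)%E by rewrite lee_fin mulr_ge0// relu_ge0.
rewrite (ge0_integral_normal_prob2 mH H0).
(* The power x^3 comes from one factor x in each relu and one in the Jacobian. Written with [relu],
   it vanishes for x <= 0, so Tonelli applies on the whole plane. *)
pose K (z : rT * rT) := (relu z.1 ^+ 3 * expR (- ((1 + z.2 ^+ 2) / 2 * z.1 ^+ 2)) *
  (a * normal_peak 1 ^+ 2 * relu (b + c * z.2)))%:E.
have mK : measurable_fun setT K.
  apply/measurable_EFinP; apply: measurable_funM; last first.
    apply: measurable_funM => //; apply: measurableT_comp measurable_relu _.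
    by apply: measurable_funD => //; apply: measurable_funM.
  apply: measurable_funM.
    by apply: measurable_funX; exact: measurableT_comp measurable_relu measurable_fst.
  apply: measurableT_comp => //; apply: measurableT_comp => //.
  apply: measurable_funM; last exact: measurable_funX.
  apply: measurable_funM => //; apply: measurable_funD => //; exact: measurable_funX.
have K0 z : (0 <= K z)%E.
  by rewrite lee_fin !mulr_ge0 ?exprn_ge0 ?relu_ge0 ?expR_ge0 ?normal_peak_ge0.
transitivity (\int[mu]_x \int[mu]_y K (x, y))%E.
  apply: eq_integral => x _.
  have [x0|x0] := leP x 0.
    rewrite !integral0_eq// => y _; rewrite /H /K /=.
      by rewrite (@relu_neg x)// expr0n/= !mul0r.
    by rewrite (@relu_neg (a * x)) ?mul0r ?mul0e// mulr_ge0_le0.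
  rewrite (@ge0_integral_affine _ x 0)//; last 2 first.
  - apply: emeasurable_funM; first exact: measurableT_comp mH (pair1_measurable x).
    exact: measurableT_comp measurable_normal_pdfM (pair1_measurable x).
  - by move=> y; rewrite mule_ge0// lee_fin mulr_ge0// normal_pdf_ge0.
  rewrite -ge0_integralZl//; last 3 first.
  - have mz : measurable_fun setT (fun y : rT => (x, (x * y + 0)%R) : rT * rT).
      by apply: measurable_fun_pair => //; apply: measurable_funD => //; exact: measurable_funM.
    apply: emeasurable_funM; first exact: measurableT_comp mH mz.
    exact: measurableT_comp measurable_normal_pdfM mz.
  - by move=> y _; rewrite mule_ge0// lee_fin mulr_ge0// normal_pdf_ge0.
  - by rewrite lee_fin ltW.
  apply: eq_integral => y _; rewrite /H /K /= addr0 -!EFinM; congr EFin.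
  rewrite normal_pdf01M.
  have -> : b * x + c * (x * y) = x * (b + c * y) by ring.
  rewrite (relu_pMl _ a0) (relu_pMl _ (ltW x0)) (relu_pos (ltW x0)).
  have -> : - (x ^+ 2 + (x * y) ^+ 2) / 2 = - ((1 + y ^+ 2) / 2 * x ^+ 2) by ring.
  ring.
transitivity (\int[mu]_y \int[mu]_x K (x, y))%E.
  exact: (@fubini_tonelli _ _ _ _ _ mu mu K).
have n0 (y : R) : 0 < 1 + y ^+ 2 by rewrite ltr_pwDl// sqr_ge0.
(* The radial integral is [integral_cube_gauss] at q = 1 + y^2; its numerator 2 times the squared
   peak 1 / (2 pi) leaves 1 / pi. *)
transitivity (\int[mu]_y ((a / pi)%:E * (relu (b + c * y) / (1 + y ^+ 2) ^+ 2)%:E))%E.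
  apply: eq_integral => y _; rewrite /K /=.
  under eq_integral do rewrite EFinM.
  rewrite ge0_integralZr//; last 3 first.
  - apply/measurable_EFinP; apply: measurable_funM.
      by apply: measurable_funX; exact: measurable_relu.
    apply: measurableT_comp => //; apply: measurableT_comp => //.
    by apply: measurable_funM => //; exact: measurable_funX.
  - by move=> x _; rewrite lee_fin mulr_ge0 ?exprn_ge0 ?relu_ge0 ?expR_ge0.
  - by rewrite lee_fin !mulr_ge0 ?exprn_ge0 ?relu_ge0 ?normal_peak_ge0.
  have -> : (\int[mu]_x (relu x ^+ 3 * expR (- ((1 + y ^+ 2) / 2 * x ^+ 2)))%:E =
      (2 / (1 + y ^+ 2) ^+ 2)%:E)%E.
    rewrite -(integral_cube_gauss (n0 y)) [RHS]integral_mkcond.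
    apply: eq_integral => x _; rewrite patchE.
    case: ifPn; rewrite ?inE ?notin_setE/= in_itv/= andbT => h.
      by rewrite relu_pos.
    by move/negP: h; rewrite -ltNge => /ltW h; rewrite relu_neg// expr0n/= mul0r.
  rewrite -!EFinM normal_peak1_sqr; congr EFin.
  move: (pi_gt0 R); generalize (@pi R) => p p0; field.
  by rewrite (gt_eqF (n0 y)) (gt_eqF p0).
rewrite ge0_integralZl//; last 3 first.
- apply/measurable_EFinP; apply: measurable_funM.
    apply: measurableT_comp measurable_relu _.
    by apply: measurable_funD => //; apply: measurable_funM.
  apply: continuous_measurable_fun; exact: continuous_sqr_oneDsqrV.
- by move=> y _; rewrite lee_fin divr_ge0 ?relu_ge0// exprn_ge0// ltW.
- by rewrite lee_fin divr_ge0// pi_ge0.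
rewrite tE -EFinM; congr EFin.
move: (pi_gt0 R); generalize (@pi R) => p p0; field.
by rewrite gt_eqF.
Qed.

End ReluPair.

(** * Finite Gaussian means, and the closed form of the mean of a relu product *)

Section Expectation.
Context {R : realType}.
Local Notation rT := (measurableTypeR R).

(** [gmeas] has to start from some parameter type; a dummy one serves for functions of the
    coordinates alone. *)
Definition gmeasr (k : nat) (g : seq R -> R) : Prop :=
  gmeas k (fun (_ : rT) s => (g s)%:E).

Lemma gmeas_EFin2 (op : R -> R -> R) (k : nat) :
  (forall d (T : measurableType d) (f g : T -> rT), measurable_fun setT f ->
     measurable_fun setT g -> measurable_fun setT (fun x => op (f x) (g x) : rT)) ->
  forall d (T : measurableType d) (f g : T -> seq R -> R),
  gmeas k (fun t s => (f t s)%:E) -> gmeas k (fun t s => (g t s)%:E) ->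
  gmeas k (fun t s => (op (f t s) (g t s))%:E).
Proof.
move=> mop; elim: k => [|k IH] d T f g /=.
  by move=> /measurable_EFinP mf /measurable_EFinP mg; apply/measurable_EFinP; exact: mop.
move=> mf mg.
exact: (IH _ _ (fun (p : T * rT) s => f p.1 (p.2 :: s))
  (fun (p : T * rT) s => g p.1 (p.2 :: s))).
Qed.

Lemma gmeasrD k (f g : seq R -> R) : gmeasr k f -> gmeasr k g ->
  gmeasr k (fun s => f s + g s).
Proof.
apply: (@gmeas_EFin2 +%R) => d T f' g' mf' mg'; exact: measurable_funD.
Qed.

Lemma gmeasrB k (f g : seq R -> R) : gmeasr k f -> gmeasr k g ->
  gmeasr k (fun s => f s - g s).
Proof.
apply: (@gmeas_EFin2 (fun x y => x - y)) => d T f' g' mf' mg'; exact: measurable_funB.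
Qed.

Lemma gmeasrM k (f g : seq R -> R) : gmeasr k f -> gmeasr k g ->
  gmeasr k (fun s => f s * g s).
Proof.
apply: (@gmeas_EFin2 *%R) => d T f' g' mf' mg'; exact: measurable_funM.
Qed.

Lemma gmeasr_cst k (c : R) : gmeasr k (fun=> c).
Proof. exact: gmeas_cst. Qed.

Lemma gmeasr_sum k n (f : 'I_n -> seq R -> R) : (forall i, gmeasr k (f i)) ->
  gmeasr k (fun s => \sum_i f i s).
Proof.
elim: n f => [|n IH] f mf.
  by under eq_fun do rewrite big_ord0; exact: gmeasr_cst.
under eq_fun do rewrite big_ord_recl.
by apply: gmeasrD => //; apply: IH.
Qed.

Lemma gmeasr_relu k (w : 'I_k -> R) : gmeasr k (fun s => relu (lform w s)).
Proof.
have mg : measurable_fun setT (fun z : rT * rT => (relu z.1)%:E).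
  apply/measurable_EFinP; exact: measurableT_comp measurable_relu measurable_fst.
have m0 : measurable_fun setT (cst 0 : rT -> rT) by [].
have := gmeas_lform2 w w mg m0 m0; congr (gmeas k _).
by apply/funext => t; apply/funext => s; rewrite /= add0r.
Qed.

(** Carrying sign, measurability and a finite value together lets means be added and compared as
    real numbers. *)
Definition gmean (k : nat) (g : seq R -> R) (x : R) : Prop :=
  [/\ forall s, 0 <= g s, gmeasr k g & gaussE k (fun s => (g s)%:E) = x%:E].

Lemma gmeanD k (f g : seq R -> R) x y : gmean k f x -> gmean k g y ->
  gmean k (fun s => f s + g s) (x + y).
Proof.
move=> [f0 mf fE] [g0 mg gE]; split; [by move=> s; rewrite addr_ge0|exact: gmeasrD|].
rewrite EFinD -fE -gE.
exact: (@gaussED R k _ rT (fun _ s => (f s)%:E) (fun _ s => (g s)%:E) 0).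
Qed.

(** Additivity holds in the extended reals; a finite mean of the sum excludes an infinite mean of
    [g], and then [x] can be subtracted. *)
Lemma gmean_subr k (f g : seq R -> R) x y : gmean k f x ->
  (forall s, 0 <= g s) -> gmeasr k g -> gmean k (fun s => f s + g s) y ->
  gmean k g (y - x).
Proof.
move=> [f0 mf fE] g0 mg [_ _ fgE]; split => //.
have : (gaussE k (fun s => (f s + g s)%:E) =
    gaussE k (fun s => (f s)%:E) + gaussE k (fun s => (g s)%:E))%E.
  exact: (@gaussED R k _ rT (fun _ s => (f s)%:E) (fun _ s => (g s)%:E) 0).
rewrite fgE fE; case: (gaussE k (fun s => (g s)%:E)) => //= r.
by move=> -[->]; rewrite addrAC subrr add0r.
Qed.

Lemma eq_gmean k (f g : seq R -> R) x : f =1 g -> gmean k f x -> gmean k g x.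
Proof. by move=> /funext ->. Qed.

Lemma gmean_ge0 k (g : seq R -> R) x : gmean k g x -> 0 <= x.
Proof.
move=> [g0 _ gE]; rewrite -lee_fin -gE; exact: gaussE_ge0.
Qed.

Lemma le_gmean k (f g : seq R -> R) x y : (forall s, f s <= g s) ->
  gmean k f x -> gmean k g y -> x <= y.
Proof.
move=> fg mf mg; rewrite -subr_ge0; apply: (@gmean_ge0 k (fun s => g s - f s)).
apply: (gmean_subr mf) => [s||]; first by rewrite subr_ge0.
  by apply: gmeasrB; [have [] := mg|have [] := mf].
by apply: eq_gmean mg => s; rewrite addrC subrK.
Qed.

Lemma gmean0 k : gmean k (fun=> 0) 0.
Proof.
split => //; first exact: gmeasr_cst.
by elim: k => [|k IH] //=; rewrite integral0_eq// => x _.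
Qed.

Lemma gmean_sum k n (f : 'I_n -> seq R -> R) (x : 'I_n -> R) :
  (forall i, gmean k (f i) (x i)) -> gmean k (fun s => \sum_i f i s) (\sum_i x i).
Proof.
elim: n f x => [|n IH] f x fx.
  by rewrite big_ord0; under eq_fun do rewrite big_ord0; exact: gmean0.
rewrite big_ord_recl; under eq_fun do rewrite big_ord_recl.
by apply: gmeanD => //; apply: IH.
Qed.

Lemma gmean_half k (g : seq R -> R) x : (forall s, 0 <= g s) -> gmeasr k g ->
  gmean k (fun s => g s + g s) (x + x) -> gmean k g x.
Proof.
move=> g0 mg [_ _ ggE]; split => //.
have : (gaussE k (fun s => (g s + g s)%:E) =
    gaussE k (fun s => (g s)%:E) + gaussE k (fun s => (g s)%:E))%E.
  exact: (@gaussED R k _ rT (fun _ s => (g s)%:E) (fun _ s => (g s)%:E) 0).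
rewrite ggE; case: (gaussE k (fun s => (g s)%:E)) => //= r.
by move=> -[h]; congr EFin; lra.
Qed.

Definition rdot {k} (u v : 'rV[R]_k) : R := \sum_j u 0 j * v 0 j.

Definition relu_prod {k} (u v : 'rV[R]_k) (s : seq R) : R :=
  relu (lform (fun j => u 0 j) s) * relu (lform (fun j => v 0 j) s).

Definition Erelu {k} (u v : 'rV[R]_k) : R :=
  fine (gaussE k (fun s => (relu_prod u v s)%:E)).

(** Here a = |u|, b^2 + c^2 = |v|^2 and a b = u.v in [gaussian_pair], so the planar formula becomes
    one in norms and inner product. *)
Lemma gaussE_relu_prod k (u v : 'rV[R]_k) :
  exists t, [/\ is_angle t, rdot u v = eucl u * eucl v * sin t &
    gaussE k (fun s => (relu_prod u v s)%:E) =
    (rdot u v / 4 + (rdot u v * t + eucl u * eucl v * cos t) / (2 * pi))%:E].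
Proof.
have [a [b [c [a0 c0 [aE abE bcE] gE]]]] := gaussian_pair (fun j => u 0 j) (fun j => v 0 j).
have [t [t1 bE cE tE]] := integral_relu_pair b a0 c0.
have auE : a = eucl u by rewrite /eucl -aE sqrtr_sqr ger0_norm.
rewrite bcE -/(eucl v) in bE cE.
have abE' : a * b = rdot u v by [].
exists t; split => //; first by rewrite -abE' auE {1}bE mulrA.
rewrite /relu_prod (gE (fun z => (relu z.1 * relu z.2)%:E)).
- rewrite tE; congr EFin; rewrite -abE' -(mulrA (eucl u)) -cE -auE.
  by move: (@pi R) => p; ring.
- apply/measurable_EFinP; apply: measurable_funM; apply: measurableT_comp measurable_relu _ => //.
- by move=> z; rewrite lee_fin mulr_ge0// relu_ge0.
Qed.

Lemma gmean_relu_prod k (u v : 'rV[R]_k) : gmean k (relu_prod u v) (Erelu u v).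
Proof.
split; first by move=> s; rewrite mulr_ge0// relu_ge0.
  by apply: gmeasrM; exact: gmeasr_relu.
by have [t [_ _ h]] := gaussE_relu_prod u v; rewrite /Erelu h.
Qed.

Lemma Erelu_angle k (u v : 'rV[R]_k) :
  exists t, [/\ is_angle t, rdot u v = eucl u * eucl v * sin t &
    Erelu u v = rdot u v / 4 + (rdot u v * t + eucl u * eucl v * cos t) / (2 * pi)].
Proof.
have [t [t1 t2 h]] := gaussE_relu_prod u v.
by exists t; split => //; rewrite /Erelu h.
Qed.

Lemma EreluC k (u v : 'rV[R]_k) : Erelu u v = Erelu v u.
Proof.
by rewrite /Erelu; congr fine; apply: eq_gaussE => s; rewrite /relu_prod mulrC.
Qed.

End Expectation.

(** * Euclidean inner products and the mixed second difference of [Erelu] *)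

Section EuclideanAlgebra.
Context {R : realType} {k : nat}.
Implicit Types u v w d : 'rV[R]_k.

Lemma rdotC u v : rdot u v = rdot v u.
Proof. by apply: eq_bigr => j _; rewrite mulrC. Qed.

Lemma rdotDl u v w : rdot (u + v) w = rdot u w + rdot v w.
Proof. by rewrite /rdot -big_split; apply: eq_bigr => j _; rewrite mxE mulrDl. Qed.

Lemma rdotZl (c : R) u v : rdot (c *: u) v = c * rdot u v.
Proof. by rewrite /rdot mulr_sumr; apply: eq_bigr => j _; rewrite mxE mulrA. Qed.

Lemma rdotDr u v w : rdot w (u + v) = rdot w u + rdot w v.
Proof. by rewrite rdotC rdotDl !(rdotC w). Qed.

Lemma rdotZr (c : R) u v : rdot u (c *: v) = c * rdot u v.
Proof. by rewrite rdotC rdotZl rdotC. Qed.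

Lemma eucl_ge0 u : 0 <= eucl u. Proof. exact: sqrtr_ge0. Qed.

Lemma sqr_eucl u : eucl u ^+ 2 = rdot u u.
Proof.
rewrite sqr_sqrtr; last by apply: sumr_ge0 => j _; exact: sqr_ge0.
by apply: eq_bigr => j _; rewrite expr2.
Qed.

Lemma euclN u : eucl (- u) = eucl u.
Proof. by rewrite /eucl; congr Num.sqrt; apply: eq_bigr => j _; rewrite mxE sqrrN. Qed.

Lemma rdot_eucl0 u v : eucl u = 0 -> rdot u v = 0.
Proof.
move=> /eqP; rewrite sqrtr_eq0 => u0.
have : \sum_j u 0 j ^+ 2 == 0.
  by rewrite eq_le u0; apply: sumr_ge0 => j _; exact: sqr_ge0.
rewrite psumr_eq0; last by move=> j _; exact: sqr_ge0.
move=> /allP uj; rewrite /rdot big1// => j _.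
by have := uj j; rewrite mem_index_enum sqrf_eq0 => /(_ isT)/eqP ->; rewrite mul0r.
Qed.

(** Cauchy-Schwarz, by expanding the square of the norm of |v| u - |u| v. *)
Lemma rdot_le u v : rdot u v <= eucl u * eucl v.
Proof.
have [u0|u0] := eqVneq (eucl u) 0; first by rewrite rdot_eucl0// u0 mul0r.
have [v0|v0] := eqVneq (eucl v) 0; first by rewrite rdotC rdot_eucl0// v0 mulr0.
have u1 : 0 < eucl u by rewrite lt_neqAle eq_sym u0 eucl_ge0.
have v1 : 0 < eucl v by rewrite lt_neqAle eq_sym v0 eucl_ge0.
have := sqr_ge0 (eucl (eucl v *: u + (- eucl u) *: v)).
rewrite sqr_eucl !(rdotDl, rdotDr, rdotZl, rdotZr) -!sqr_eucl (rdotC v u).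
rewrite [X in 0 <= X](_ : _ =
  (eucl u * eucl v) * (2 * (eucl u * eucl v - rdot u v))); last by ring.
by rewrite pmulr_rge0 ?mulr_gt0// pmulr_rge0// subr_ge0.
Qed.

Lemma lformB u v s :
  lform (fun j => (u - v) 0 j) s = lform (fun j => u 0 j) s - lform (fun j => v 0 j) s.
Proof. by rewrite /lform -sumrB; apply: eq_bigr => j _; rewrite !mxE mulrBl. Qed.

Lemma Erelu_self u : Erelu u u = eucl u ^+ 2 / 2.
Proof.
have [t [t1 tE ->]] := Erelu_angle u u.
move: tE; rewrite -sqr_eucl -expr2 => tE.
have [->|u0] := eqVneq (eucl u ^+ 2) 0; first by rewrite !mul0r addr0 mul0r addr0.
have st : sin t = 1 by apply: (mulfI u0); rewrite -tE mulr1.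
have tpi : t = pi / 2.
  apply: sin_inj; rewrite ?st ?sin_pihalf// in_itv//=.
  by have := pi_ge0 R; lra.
rewrite tpi cos_pihalf; have := pi_gt0 R; move: (@pi R) => p p0; field.
by rewrite gt_eqF.
Qed.

Lemma relu_lip2 (a b : R) : (relu a - relu b) ^+ 2 <= (a - b) ^+ 2.
Proof.
have [a0|/ltW a0] := leP 0 a; have [b0|/ltW b0] := leP 0 b.
- by rewrite !relu_pos.
- by rewrite (relu_pos a0) (relu_neg b0); have := mulr_ge0_le0 a0 b0; nra.
- by rewrite (relu_neg a0) (relu_pos b0); have := mulr_le0_ge0 a0 b0; nra.
- by rewrite !relu_neg// subrr expr0n sqr_ge0.
Qed.

(** With this, the mean of a squared linear form follows from [Erelu_self]. *)
Lemma relu_sqrD (a b : R) : relu (a - b) * relu (a - b) + relu (b - a) * relu (b - a) = (a - b) ^+ 2.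
Proof.
have [ab|/ltW ab] := leP 0 (a - b).
  rewrite (relu_pos ab) (@relu_neg _ (b - a)); last lra.
  by ring.
rewrite (relu_neg ab) (@relu_pos _ (b - a)); last lra.
by ring.
Qed.

(** The left side is the mean of (relu a' - relu a)(relu b' - relu b), bounded pointwise by AM-GM
    and [relu_lip2]. Both sides are doubled and negative terms moved across, so that only
    nonnegative functions are integrated. *)
Lemma Erelu_cross_le w w' u u' :
  Erelu w' u' + Erelu w u - Erelu w' u - Erelu w u' <=
  (eucl (w' - w) ^+ 2 + eucl (u' - u) ^+ 2) / 2.
Proof.
have m1 := gmeanD (gmean_relu_prod w' u') (gmean_relu_prod w u).
have m1' := gmeanD m1 m1.
have m2 := gmeanD (gmean_relu_prod w' u) (gmean_relu_prod w u').
have m2' := gmeanD m2 m2.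
have q (a b : 'rV[R]_k) := gmeanD (gmean_relu_prod (a - b) (a - b)) (gmean_relu_prod (b - a) (b - a)).
have m3 := gmeanD m2' (gmeanD (q w' w) (q u' u)).
suff pw : forall s : seq R,
    relu_prod w' u' s + relu_prod w u s + (relu_prod w' u' s + relu_prod w u s) <=
    relu_prod w' u s + relu_prod w u' s + (relu_prod w' u s + relu_prod w u' s) +
    (relu_prod (w' - w) (w' - w) s + relu_prod (w - w') (w - w') s +
     (relu_prod (u' - u) (u' - u) s + relu_prod (u - u') (u - u') s)).
  have := le_gmean pw m1' m3.
  by rewrite !Erelu_self -(opprB w' w) -(opprB u' u) !euclN; lra.
move=> s; rewrite /relu_prod !lformB !relu_sqrD.
move: (lform (fun j => w 0 j) s) (lform (fun j => w' 0 j) s)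
  (lform (fun j => u 0 j) s) (lform (fun j => u' 0 j) s) => a a' b b'.
have := sqr_ge0 ((relu a' - relu a) - (relu b' - relu b)).
have := relu_lip2 a' a; have := relu_lip2 b' b.
move: (relu a) (relu a') (relu b) (relu b') => ra ra' rb rb'; lra.
Qed.

Lemma Erelu_cross w w' u u' :
  `|Erelu w' u' + Erelu w u - Erelu w' u - Erelu w u'| <=
  (eucl (w' - w) ^+ 2 + eucl (u' - u) ^+ 2) / 2.
Proof.
rewrite ler_norml Erelu_cross_le andbT.
by have := Erelu_cross_le w' w u u'; rewrite -(opprB w' w) euclN; lra.
Qed.

End EuclideanAlgebra.

(** * The objective as a combination of [Erelu] terms *)

Section Objective.
Context {R : realType} {n k : nat}.

Lemma lform_row m (M : 'M[R]_(m, k)) i s :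
  lform (fun j => row i M 0 j) s = \sum_(j < k) M i j * nth 0 s j.
Proof. by apply: eq_bigr => j _; rewrite mxE. Qed.

Lemma gmean_sum_relu m p (M : 'M[R]_(m, k)) (N : 'M[R]_(p, k)) :
  gmean k (fun s => (\sum_(i < m) relu (\sum_(j < k) M i j * nth 0 s j)) *
                    (\sum_(i < p) relu (\sum_(j < k) N i j * nth 0 s j)))
    (\sum_(i < m) \sum_(j < p) Erelu (row i M) (row j N)).
Proof.
apply: (@eq_gmean _ _ (fun s => \sum_(i < m) \sum_(j < p) relu_prod (row i M) (row j N) s)).
  move=> s; rewrite mulr_suml; apply: eq_bigr => i _; rewrite mulr_sumr.
  by apply: eq_bigr => j _; rewrite /relu_prod !lform_row.
by apply: gmean_sum => i; apply: gmean_sum => j; exact: gmean_relu_prod.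
Qed.

Lemma gmeasr_sum_relu m (M : 'M[R]_(m, k)) :
  gmeasr k (fun s => \sum_(i < m) relu (\sum_(j < k) M i j * nth 0 s j)).
Proof. by apply: gmeasr_sum => i; exact: (gmeasr_relu (fun j => M i j)). Qed.

(** Twice the loss plus twice the cross product equals the sum of the two squares: an identity
    between nonnegative functions, from which [gmean_subr] and [gmean_half] extract the mean of the
    loss. *)
Lemma FobjE (Vm : 'M[R]_(k, k)) (W : 'M[R]_(n, k)) :
  Fobj Vm W = 2^-1 * (\sum_(i < n) \sum_(j < n) Erelu (row i W) (row j W)) +
    2^-1 * (\sum_(i < k) \sum_(j < k) Erelu (row i Vm) (row j Vm)) -
    \sum_(i < n) \sum_(j < k) Erelu (row i W) (row j Vm).
Proof.
set A := \sum_i _; set B := \sum_i _; set C := \sum_i _.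
have mA := gmean_sum_relu W W; have mB := gmean_sum_relu Vm Vm.
have mC := gmean_sum_relu W Vm.
rewrite -/A in mA; rewrite -/B in mB; rewrite -/C in mC.
have mL : gmeasr k (loss Vm W).
  apply: gmeasrM; first exact: gmeasr_cst.
  by under eq_fun do rewrite expr2; apply: gmeasrM; apply: gmeasrB; exact: gmeasr_sum_relu.
have L0 s : 0 <= loss Vm W s by rewrite mulr_ge0 ?invr_ge0// sqr_ge0.
suff [_ _ h] : gmean k (loss Vm W) (2^-1 * A + 2^-1 * B - C) by rewrite /Fobj h.
apply: gmean_half => //.
have -> : 2^-1 * A + 2^-1 * B - C + (2^-1 * A + 2^-1 * B - C) = A + B - (C + C) by field.
apply: (gmean_subr (gmeanD mC mC)).
- by move=> s; rewrite addr_ge0.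
- exact: gmeasrD.
- apply: eq_gmean (gmeanD mA mB) => s; rewrite /loss.
  by field.
Qed.

End Objective.

(** * Trigonometric inequalities *)

Section Angles.
Context {R : realType}.
Implicit Types s t x : R.

Lemma le_sin_angle s t : is_angle s -> is_angle t -> s <= t -> sin s <= sin t.
Proof.
move=> hs ht; rewrite le_eqVlt => /predU1P[->//|st].
by apply/ltW; rewrite ltr_sin// in_itv.
Qed.

(** Cosine is concave on [-pi/2, pi/2], so it lies below its tangent at [t]. *)
Lemma cos_tangent s t : is_angle s -> is_angle t ->
  cos s <= sin t * (t - s) + cos t.
Proof.
move=> hs ht.
have d (x : R) : is_derive x 1 (@cos R) (- sin x) by exact: is_derive_cos.
have c (a b : R) : {within `[a, b], continuous (@cos R)}.
  by apply: continuous_subspaceT => x; exact: continuous_cos.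
have [st|/ltW ts] := leP s t.
  have [x] := MVT_segment st (fun x _ => d x) (c _ _).
  rewrite in_itv/= => /andP[sx xt] h.
  have hx : is_angle x by move: hs ht; rewrite /is_angle; lra.
  have := le_sin_angle hx ht xt; nra.
have [x] := MVT_segment ts (fun x _ => d x) (c _ _).
rewrite in_itv/= => /andP[tx xs] h.
have hx : is_angle x by move: hs ht; rewrite /is_angle; lra.
have := le_sin_angle ht hx tx; nra.
Qed.

(* The difference of the two sides vanishes at [x = 0] and has derivative
   [2 sin x (1 - cos (t - x))]. *)
Lemma angle_defect t x : 0 <= x <= pi ->
  cos t * sin x ^+ 2 + sin t * (x - sin x * cos x) <= 2 * (1 - cos x).
Proof.
move=> /andP[x0 xpi].
pose Phi (y : R) : R := 2 * (1 - cos y) - cos t * sin y ^+ 2 - sin t * (y - sin y * cos y).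
have dPhi (y : R) : is_derive y 1 Phi (2 * sin y * (1 - cos (t - y))).
  rewrite /Phi; apply: is_derive_eq.
  have h := cos2sin2 y; rewrite /GRing.scale/= cosB; ring: h.
have cPhi : {within `[0, x], continuous Phi}.
  apply: continuous_subspaceT => y; apply: differentiable_continuous.
  by apply/derivable1_diffP; have [] := dPhi y.
have [y] := MVT_segment x0 (fun y _ => dPhi y) cPhi.
rewrite in_itv/= => /andP[y0 yx].
have -> : Phi 0 = 0 by rewrite /Phi cos0 sin0; ring.
rewrite !subr0 => h; suff : 0 <= Phi x by rewrite /Phi; lra.
by rewrite h !mulr_ge0// sin_ge0_pi// y0 (le_trans yx).
Qed.

(** Expanding cos s = cos (t - x) with x = t - s turns this into [angle_defect]; for x < 0 the signs
    of both [t] and [x] are changed. *)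
Lemma cos_tangent_defect s t : is_angle s -> is_angle t ->
  sin t * (t - s) + cos t - 2 + (2 - cos s) * cos (t - s) <= 0.
Proof.
move=> hs ht; set x := t - s.
have sE : cos s = cos t * cos x + sin t * sin x.
  by rewrite -cosB /x; congr cos; ring.
have E : sin t * x + cos t - 2 + (2 - cos s) * cos x =
    cos t * sin x ^+ 2 + sin t * (x - sin x * cos x) - 2 * (1 - cos x).
  by rewrite sE sin2cos2; ring.
rewrite E subr_le0.
have [x0|/ltW x0] := leP 0 x.
  by apply: angle_defect; move: hs ht; rewrite /is_angle /x in x0 *; lra.
have := @angle_defect (- t) (- x).
rewrite !cosN !sinN; have -> : (- sin x) ^+ 2 = sin x ^+ 2 by rewrite sqrrN.
have -> : - sin t * (- x - - sin x * cos x) = sin t * (x - sin x * cos x) by ring.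
by apply; move: hs ht; rewrite /is_angle /x in x0 *; lra.
Qed.

End Angles.

(** * First-order Taylor remainder of [Erelu] in one argument *)

Section Remainder.
Context {R : realType} {k : nat}.
Implicit Types u v w d : 'rV[R]_k.

Lemma cos_angle_ge0 (t : R) : is_angle t -> 0 <= cos t.
Proof. exact: cos_ge0_pihalf. Qed.

(* Triangle inequality on the sphere: the components of [w] and [w'] orthogonal
   to [v] have norms [|w| cos t] and [|w'| cos t']. *)
Lemma rdot_le_cosB w w' v (t t' : R) : is_angle t -> is_angle t' -> 0 < eucl v ->
  rdot w v = eucl w * eucl v * sin t -> rdot w' v = eucl w' * eucl v * sin t' ->
  rdot w w' <= eucl w * eucl w' * cos (t' - t).
Proof.
move=> ht ht' v0 tE t'E.
pose P u := eucl v *: u + (- (rdot u v / eucl v)) *: v.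
have PP u u' : rdot (P u) (P u') = eucl v ^+ 2 * rdot u u' - rdot u v * rdot u' v.
  rewrite /P !(rdotDl, rdotDr, rdotZl, rdotZr) -(sqr_eucl v) (rdotC v u').
  by field; rewrite gt_eqF.
have nP u (s : R) : is_angle s -> rdot u v = eucl u * eucl v * sin s ->
    eucl (P u) = eucl v * eucl u * cos s.
  move=> hs sE; apply/eqP; rewrite -(@eqrXn2 _ 2)//; last 2 first.
  - exact: eucl_ge0.
  - by rewrite !mulr_ge0 ?eucl_ge0// cos_angle_ge0.
  by rewrite sqr_eucl PP sE -sqr_eucl !exprMn cos2sin2; apply/eqP; ring.
have := rdot_le (P w) (P w'); rewrite PP (nP _ _ ht tE) (nP _ _ ht' t'E) tE t'E cosB.
move=> h; rewrite -(ler_pM2l (exprn_gt0 2 v0)).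
lra.
Qed.

(* With [e] the component of [w + d] along [w], the remainder equals
   [|v| (|w + d| (sin t' (t' - t) + cos t') - e cos t) / (2 pi)], and
   [2 (|w + d| - e) <= |d|^2 / |w|]. *)
Lemma Erelu_taylor w v : 0 < eucl w -> exists L : 'rV[R]_k -> R,
  (forall c d, L (c *: d) = c * L d) /\
  forall d, 0 <= Erelu (w + d) v - Erelu w v - L d <=
    eucl v * eucl d ^+ 2 / (2 * pi * eucl w).
Proof.
move=> N0; have [t [ht tE fE]] := Erelu_angle w v.
have p0 := pi_gt0 R.
(* The derivative of the closed form with [t] held fixed: its derivative in [t] is proportional to
   w.v - |w| |v| sin t = 0. *)
exists (fun d => rdot d v / 4 +
  (t * rdot d v + cos t * eucl v * (rdot w d / eucl w)) / (2 * pi)); split.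
  by move=> c d; rewrite rdotZl rdotZr; move: (@pi R) => p; ring.
move=> d; have [t' [ht' t'E f'E]] := Erelu_angle (w + d) v.
pose e := rdot w (w + d) / eucl w.
have eN : rdot w (w + d) = e * eucl w by rewrite /e divfK// gt_eqF.
have remE : Erelu (w + d) v - Erelu w v -
    (rdot d v / 4 + (t * rdot d v + cos t * eucl v * (rdot w d / eucl w)) / (2 * pi)) =
    eucl v * (eucl (w + d) * (sin t' * (t' - t) + cos t') - cos t * e) / (2 * pi).
  have -> : rdot d v = rdot (w + d) v - rdot w v by rewrite rdotDl; ring.
  have -> : rdot w d = e * eucl w - eucl w ^+ 2 by rewrite -eN rdotDr -sqr_eucl; ring.
  rewrite fE f'E tE t'E; move: (@pi R) p0 => p p0; field.
  by rewrite !gt_eqF.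
have N'0 := eucl_ge0 (w + d); have V0 := eucl_ge0 v.
have eN' : e <= eucl (w + d) by rewrite ler_pdivrMr// mulrC rdot_le.
have ct := cos_angle_ge0 ht.
rewrite remE; apply/andP; split.
  apply: divr_ge0; last by rewrite mulr_ge0// ltW.
  apply: mulr_ge0 => //; rewrite subr_ge0.
  apply: (@le_trans _ _ (cos t * eucl (w + d))); first by rewrite ler_wpM2l.
  by rewrite mulrC ler_wpM2l// cos_tangent.
have dE : 2 * (eucl (w + d) - e) <= eucl d ^+ 2 / eucl w.
  rewrite ler_pdivlMr//.
  have -> : eucl d ^+ 2 = eucl (w + d) ^+ 2 + eucl w ^+ 2 - 2 * (e * eucl w).
    by rewrite -eN !sqr_eucl !(rdotDl, rdotDr) (rdotC d w); ring.
  by have := sqr_ge0 (eucl (w + d) - eucl w); lra.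
have -> : eucl v * eucl d ^+ 2 / (2 * pi * eucl w) =
    eucl v * (eucl d ^+ 2 / eucl w) / (2 * pi).
  by move: (@pi R) p0 => p p0; field; rewrite (gt_eqF p0) (gt_eqF N0).
apply: ler_wpM2r; first by rewrite invr_ge0 mulr_ge0// ltW.
have [v0|v0] := eqVneq (eucl v) 0; first by rewrite v0 !mul0r.
apply: ler_wpM2l => //; apply: le_trans dE.
(* Since 2 - cos t >= 0, replacing e by |w + d| cos (t' - t) leaves |w + d| times
   [cos_tangent_defect]. *)
have eC : e <= eucl (w + d) * cos (t' - t).
  rewrite ler_pdivrMr//; have v1 : 0 < eucl v by rewrite lt_neqAle eq_sym v0 V0.
  by have := rdot_le_cosB ht ht' v1 tE t'E; lra.
have := cos_tangent_defect ht ht'; have c1 := cos_le1 t.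
rewrite -subr_ge0 => h; have h1 := mulr_ge0 N'0 h.
have c2 : 0 <= 2 - cos t by lra.
have := ler_wpM2l c2 eC; lra.
Qed.

End Remainder.

(** * First-order Taylor remainder of the objective *)

Section Taylor.
Context {R : realType} {n k : nat}.
Implicit Types (W D : 'M[R]_(n, k)) (Vm : 'M[R]_(k, k)).

Lemma frob_ge0 D : 0 <= frob D. Proof. exact: sqrtr_ge0. Qed.

Lemma sqr_frob D : frob D ^+ 2 = \sum_i eucl (row i D) ^+ 2.
Proof.
rewrite sqr_sqrtr; last first.
  by apply: sumr_ge0 => i _; apply: sumr_ge0 => j _; exact: sqr_ge0.
apply: eq_bigr => i _; rewrite sqr_sqrtr; last first.
  by apply: sumr_ge0 => j _; exact: sqr_ge0.
by apply: eq_bigr => j _; rewrite mxE.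
Qed.

Lemma frob_row D : frob D = eucl (\row_i eucl (row i D)).
Proof.
apply/eqP; rewrite -(@eqrXn2 _ 2)// ?frob_ge0 ?eucl_ge0// sqr_frob sqr_eucl.
by apply/eqP/eq_bigr => i _; rewrite mxE expr2.
Qed.

(** Cauchy-Schwarz in each row, then for the vectors of row norms. *)
Lemma frob_cauchy D D' : `|\sum_i \sum_j D i j * D' i j| <= frob D * frob D'.
Proof.
have le D1 : \sum_i \sum_j D1 i j * D' i j <= frob D1 * frob D'.
  rewrite !frob_row; apply: le_trans (rdot_le _ _); rewrite /rdot.
  apply: ler_sum => i _; rewrite !mxE; apply: le_trans (rdot_le _ _).
  by rewrite le_eqVlt; apply/orP; left; apply/eqP/eq_bigr => j _; rewrite !mxE.
have frobN : frob (- D) = frob D.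
  by rewrite /frob; congr Num.sqrt; apply: eq_bigr => i _; apply: eq_bigr => j _;
    rewrite mxE sqrrN.
rewrite ler_norml le andbT lerNl -frobN.
apply: le_trans (le (- D)); rewrite le_eqVlt; apply/orP; left; apply/eqP.
rewrite -sumrN; apply: eq_bigr => i _; rewrite -sumrN; apply: eq_bigr => j _.
by rewrite mxE mulNr.
Qed.

Lemma Fobj_taylor Vm W (m M V : R) : 0 < m -> 0 <= V ->
  (forall i, m <= eucl (row i W) <= M) -> (forall j, eucl (row j Vm) <= V) ->
  exists G : 'M[R]_(n, k) -> R, (forall c D, G (c *: D) = c * G D) /\
  forall D, `|Fobj Vm (W + D) - Fobj Vm W - G D| <=
    (2^-1 + (n%:R * (n%:R - 1)) * (M / (2 * pi * m) + 2^-1) +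
     n%:R * k%:R * V / (2 * pi * m)) * frob D ^+ 2.
Proof.
move=> m0 V0 hW hV; have p0 := pi_gt0 R.
have w0 i : 0 < eucl (row i W) by have /andP[h _] := hW i; exact: lt_le_trans h.
have pm0 : 0 < 2 * pi * m by rewrite !mulr_gt0.
pose K := (2 * pi * m)^-1.
have K0 : 0 <= K by rewrite invr_ge0 ltW.
have tay i v (B : R) : eucl v <= B -> exists L : 'rV[R]_k -> R,
    (forall c d, L (c *: d) = c * L d) /\
    forall d, 0 <= Erelu (row i W + d) v - Erelu (row i W) v - L d <= B * K * eucl d ^+ 2.
  move=> vB; have [L [L1 L2]] := Erelu_taylor v (w0 i); exists L; split => // d.
  have /andP[-> h] := L2 d; apply: le_trans h _.
  rewrite mulrAC; apply: ler_wpM2r; first exact: sqr_ge0.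
  apply: ler_pM => //; first exact: eucl_ge0.
    by rewrite invr_ge0 !mulr_ge0 ?eucl_ge0// ltW.
  have /andP[h1 _] := hW i.
  by rewrite lef_pV2 ?posrE ?mulr_gt0// ler_pM2l// mulr_gt0.
have [L HL] := choice (fun p : 'I_n * 'I_n =>
  tay p.1 (row p.2 W) M (proj2 (andP (hW p.2)))).
have [LV HLV] := choice (fun p : 'I_n * 'I_k => tay p.1 (row p.2 Vm) V (hV p.2)).
(* On the diagonal [Erelu] is |w|^2 / 2, with differential w.d; off it, both arguments move and the
   two partial differentials add up. *)
pose q D i j : R := if i == j then rdot (row i W) (row i D)
  else L (i, j) (row i D) + L (j, i) (row j D).
pose G D := 2^-1 * (\sum_i \sum_j q D i j) - \sum_i \sum_j LV (i, j) (row i D).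
have rZ c D i : row i (c *: D) = c *: row i D by rewrite linearZ.
exists G; split.
  move=> c D; rewrite /G mulrBr mulrCA; congr (_ * _ - _).
    rewrite mulr_sumr; apply: eq_bigr => i _; rewrite mulr_sumr; apply: eq_bigr => j _.
    rewrite /q !rZ; case: ifP => _; first by rewrite rdotZr.
    by rewrite (proj1 (HL (i, j))) (proj1 (HL (j, i))) mulrDr.
  rewrite mulr_sumr; apply: eq_bigr => i _; rewrite mulr_sumr; apply: eq_bigr => j _.
  by rewrite rZ (proj1 (HLV (i, j))).
move=> D; pose x i := eucl (row i D) ^+ 2.
have x0 i : 0 <= x i by exact: sqr_ge0.
pose C := M * K + 2^-1.
(* That is, x_i on the diagonal and C (x_i + x_j) off it; the correction form makes the double sum
   computable. *)
pose b i j : R := C * (x i + x j) + (if i == j then x i - 2 * C * x i else 0).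
pose w i := row i W; pose w' i := row i W + row i D.
have rD i : row i (W + D) = w' i by rewrite linearD.
have Hpair i j : `|Erelu (w' i) (w' j) - Erelu (w i) (w j) - q D i j| <= b i j.
  rewrite /q /b; case: eqP => [<-|_].
    rewrite !Erelu_self !sqr_eucl /w' !(rdotDl, rdotDr) (rdotC (row i D)) -/(w i).
    rewrite -(sqr_eucl (row i D)) -/(x i).
    rewrite [X in `|X|](_ : _ = x i / 2); last by field.
    by rewrite ger0_norm ?divr_ge0//; have := x0 i; lra.
  (* Off the diagonal the increment is the two one-argument increments plus the mixed second
     difference, which give the M K and the 1/2 of [C]. *)
  have /andP[a1 a2] := proj2 (HL (i, j)) (row i D).
  have /andP[b1 b2] := proj2 (HL (j, i)) (row j D).
  have := Erelu_cross (w i) (w' i) (w j) (w' j).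
  rewrite {2}/w' {2}/w' [row i W + _ - _]addrAC subrr add0r.
  rewrite [row j W + _ - _]addrAC subrr add0r -/(x i) -/(x j) ler_norml => /andP[c1 c2].
  move: a1 a2 b1 b2; rewrite /= -/(w i) -/(w j) -/(w' i) -/(w' j) -/(x i) -/(x j).
  rewrite (EreluC (w' j)) (EreluC (w j) (w i)) => a1 a2 b1 b2.
  rewrite addr0 ler_norml /C; apply/andP; split; lra.
have HV i j : `|Erelu (w' i) (row j Vm) - Erelu (w i) (row j Vm) - LV (i, j) (row i D)|
    <= V * K * frob D ^+ 2.
  have /andP[a1 a2] := proj2 (HLV (i, j)) (row i D).
  rewrite ger0_norm//; apply: le_trans a2 _; apply: ler_wpM2l; first exact: mulr_ge0.
  rewrite sqr_frob (bigD1 i)//= lerDl; apply: sumr_ge0 => j' _; exact: sqr_ge0.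
have E : Fobj Vm (W + D) - Fobj Vm W - G D =
    2^-1 * (\sum_i \sum_j (Erelu (w' i) (w' j) - Erelu (w i) (w j) - q D i j)) -
    \sum_i \sum_j (Erelu (w' i) (row j Vm) - Erelu (w i) (row j Vm) - LV (i, j) (row i D)).
  rewrite !FobjE /G.
  under eq_bigr do under eq_bigr do rewrite !rD.
  under [X in _ - X - _ - _]eq_bigr do under eq_bigr do rewrite !rD.
  under [X in _ = 2^-1 * X - _]eq_bigr do rewrite !sumrB.
  under [X in _ = _ - X]eq_bigr do rewrite !sumrB.
  rewrite !sumrB; ring.
rewrite E.
have h1 : `|2^-1 * (\sum_i \sum_j (Erelu (w' i) (w' j) - Erelu (w i) (w j) - q D i j))| <=
    2^-1 * (\sum_i \sum_j b i j).
  rewrite normrM ger0_norm ?invr_ge0//; apply: ler_wpM2l; first by rewrite invr_ge0.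
  apply: le_trans (ler_norm_sum _ _ _) _; apply: ler_sum => i _.
  by apply: le_trans (ler_norm_sum _ _ _) _; apply: ler_sum => j _.
have h2 : `|\sum_i \sum_j (Erelu (w' i) (row j Vm) - Erelu (w i) (row j Vm) - LV (i, j) (row i D))| <=
    n%:R * (k%:R * (V * K * frob D ^+ 2)).
  apply: le_trans (ler_norm_sum _ _ _) _.
  apply: (@le_trans _ _ (\sum_(i < n) k%:R * (V * K * frob D ^+ 2))); last first.
    by rewrite sumr_const card_ord -[leLHS]mulr_natl.
  apply: ler_sum => i _; apply: le_trans (ler_norm_sum _ _ _) _.
  apply: (@le_trans _ _ (\sum_(j < k) (V * K * frob D ^+ 2))); first exact: ler_sum.
  by rewrite sumr_const card_ord -[leLHS]mulr_natl.
have bE : \sum_i \sum_j b i j = (1 + 2 * (n%:R - 1) * C) * frob D ^+ 2.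
  rewrite sqr_frob -/x; set S := \sum_i x i.
  have inner i : \sum_j b i j = C * (n%:R * x i + S) + (x i - 2 * C * x i).
    rewrite /b big_split/= -mulr_sumr big_split/= sumr_const card_ord.
    congr (_ + _); first by rewrite mulr_natl.
    rewrite (bigD1 i)//= eqxx big1 ?addr0// => j.
    by rewrite eq_sym => /negbTE ->.
  under eq_bigr do rewrite inner.
  rewrite big_split/= -mulr_sumr big_split/= -mulr_sumr sumr_const card_ord -(mulr_natl S).
  by rewrite sumrB -mulr_sumr -/S; ring.
apply: le_trans (ler_normB _ _) _; apply: le_trans (lerD h1 h2) _.
rewrite bE -/K.
have C0 : 0 <= C * frob D ^+ 2.
  (* A negative M contradicts the row bounds unless there are no rows, and then the norm of D is
     0. *)
  have [M0|M0] := leP 0 M; first by rewrite mulr_ge0 ?sqr_ge0// addr_ge0 ?invr_ge0// mulr_ge0.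
  rewrite sqr_frob big1 ?mulr0// => i _.
  have /andP[h1' h2'] := hW i; by have := w0 i; lra.
(* The estimate has n - 1 in front of [C], the claim n (n - 1); they differ by (n - 1)^2. *)
have := mulr_ge0 C0 (sqr_ge0 (n%:R - 1 : R)).
rewrite /C; lra.
Qed.

End Taylor.

(** * Derivatives from quadratic bounds, and bounds on row norms *)

Section Differential.
Context {R : realType} {n k : nat}.
Implicit Types (W D : 'M[R]_(n, k)) (F : 'M[R]_(n, k) -> R).

Lemma derive_of_quadratic_bound F W D (g C : R) : 0 <= C ->
  (forall h : R, `|F (W + h *: D) - F W - h * g| <= C * h ^+ 2) -> 'D_D F W = g.
Proof.
move=> C0 H; apply: cvg_lim => //; apply/cvgrPdist_le => e e0.
near=> h.
have h0 : h != 0 by near: h; exact: nbhs_dnbhs_neq.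
(* Dividing by C + 1 covers the case C = 0. *)
have hC : `|h| <= e / (C + 1).
  near: h; apply: dnbhs0_le; rewrite divr_gt0// ltr_wpDl//.
rewrite /= -normrN opprB addrC.
have -> : - g + h^-1 *: (F (h *: D + W) - F W) =
    h^-1 * (F (W + h *: D) - F W - h * g).
  by rewrite (addrC W) /GRing.scale/=; field.
rewrite normrM normfV ler_pdivrMl ?normr_gt0//.
apply: le_trans (H h) _.
have -> : h ^+ 2 = `|h| ^+ 2 by rewrite real_normK// num_real.
rewrite expr2 mulrCA; apply: ler_wpM2l => //.
rewrite ler_pdivlMr ?ltr_wpDl// in hC.
by apply: le_trans hC; rewrite mulrDr mulr1 mulrC lerDl.
Unshelve. all: by end_near. Qed.

Lemma sqr_frobZ (c : R) D : frob (c *: D) ^+ 2 = c ^+ 2 * frob D ^+ 2.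
Proof.
rewrite !sqr_frob mulr_sumr; apply: eq_bigr => i _.
by rewrite linearZ /= !sqr_eucl rdotZl rdotZr mulrA -expr2.
Qed.

(** Differentiability makes the directional derivative linear in [D], hence a Frobenius product with
    the matrix of partial derivatives. *)
Lemma grad_norm_bound F W D : differentiable F W ->
  `|'D_D F W| <= grad_norm F W * frob D.
Proof.
move=> dF.
have -> : 'D_D F W = \sum_i \sum_j (\matrix_(i, j) 'D_(delta_mx i j) F W) i j * D i j.
  rewrite deriveE// {1}(matrix_sum_delta D) linear_sum; apply: eq_bigr => i _.
  rewrite linear_sum; apply: eq_bigr => j _.
  by rewrite linearZ mxE deriveE// mulrC.
apply: le_trans (frob_cauchy _ _) _; apply: ler_wpM2r; first exact: frob_ge0.
rewrite /grad_norm /frob le_eqVlt; apply/orP; left; apply/eqP; congr Num.sqrt.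
by apply: eq_bigr => i _; apply: eq_bigr => j _; rewrite mxE.
Qed.

(** The infimum is over norms, bounded below by 0; for the supremum, compactness bounds the entries
    and hence the row norms. *)
Lemma eucl_row_bounds (A : set 'M[R]_(n, k)) W i : compact A -> A W ->
  mA A <= eucl (row i W) <= MA A.
Proof.
move=> cA AW; set E := [set r | exists W i, A W /\ r = eucl (row i W)].
have EW : E (eucl (row i W)) by exists W, i.
apply/andP; split.
  by apply: ge_inf => //; exists 0 => _ [U [j [_ ->]]]; exact: eucl_ge0.
apply: ub_le_sup => //.
have [B [_ hB]] := compact_bounded cA.
(* Boundedness is stated for every real strictly above B, whence B + 1. *)
have {}hB U : A U -> `|U| <= B + 1 by move=> AU; apply: (hB (B + 1)) => //; rewrite ltrDl.
exists (Num.sqrt (\sum_(j < k) (B + 1) ^+ 2)) => _ [U [j [AU ->]]].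
rewrite ler_wsqrtr//; apply: ler_sum => l _; rewrite mxE.
have Ujl : `|U j l| <= B + 1.
  apply: le_trans (hB U AU); rewrite [leRHS]mx_normrE.
  exact: (le_bigmax _ (fun ij : 'I_n * 'I_k => `|U ij.1 ij.2|) (j, l)).
by rewrite -[leLHS]real_normK ?num_real// lerXn2r ?nnegrE// (le_trans _ Ujl).
Qed.

End Differential.

(** * The inequality for the objective *)

Lemma Vmax_ge0 (R : realType) (k : nat) (Vm : 'M[R]_(k, k)) : 0 <= Vmax Vm.
Proof. exact: bigmax_ge_id. Qed.

Lemma eucl_row_le_Vmax (R : realType) (k : nat) (Vm : 'M[R]_(k, k)) j :
  eucl (row j Vm) <= Vmax Vm.
Proof. exact: le_bigmax. Qed.

Theorem theorem4 (R : realType) (n k : nat) (Vm : 'M[R]_(k, k))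
    (A : set 'M[R]_(n, k)) :
  compact A ->
  (forall W, A W -> thrice_differentiable_at (Fobj Vm) W) ->
  0 < mA A ->
  forall W W', A W -> A W' ->
    `|Fobj Vm W' - Fobj Vm W| <=
      frob (W' - W) * (LH Vm A * frob (W' - W) + grad_norm (Fobj Vm) W).
Proof.
move=> cA dA m0 W W' AW _; set D := W' - W.
have [G [GZ GF]] := Fobj_taylor m0 (Vmax_ge0 Vm)
  (fun i => eucl_row_bounds i cA AW) (eucl_row_le_Vmax Vm).
have {}GF U : `|Fobj Vm (W + U) - Fobj Vm W - G U| <= LH Vm A * frob U ^+ 2 by exact: GF.
have C0 : 0 <= LH Vm A * frob D ^+ 2 by apply: le_trans (GF D).
(* Along h D, homogeneity gives G (h D) = h G(D) and an error of order h^2, which pins G(D) down as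
   the directional derivative. *)
have dE : 'D_D (Fobj Vm) W = G D.
  apply: (derive_of_quadratic_bound C0) => h.
  by rewrite -GZ; apply: le_trans (GF _) _; rewrite sqr_frobZ mulrCA mulrC.
have dF : differentiable (Fobj Vm) W.
  by have [/nbhs_singleton[]] := dA W AW.
have := GF D; rewrite -dE [W + D]addrC subrK => h.
have := grad_norm_bound D dF => h'.
have -> : frob D * (LH Vm A * frob D + grad_norm (Fobj Vm) W) =
  LH Vm A * frob D ^+ 2 + grad_norm (Fobj Vm) W * frob D by ring.
apply: le_trans (lerD h h'); apply: le_trans (ler_normD _ _).
by rewrite subrK.
Qed.
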